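(* The Hopf algebra $K[X]$ (with coproduct $\Delta$), equipped with the basis of basic invariants $p(n,\sigma,n_1,\ldots,n_r)$ and with the inner product $\langle-,-\rangle$ defined in the context, is a rational PSH-algebra.
   Context: $K$ is an algebraically closed field of characteristic zero and a type $((p_1,q_1),\ldots,(p_r,q_r))\in(\mathbb{N}^2)^r$, $r\ge1$, is fixed. **The algebra $K[X]$.** A closed diagram is a finite list of boxes, each labelled by one of $x_1,\ldots,x_r$, where a box labelled $x_i$ has $q_i$ ordered input strings and $p_i$ ordered output strings, together with a bijection (connection) from the set of all output strings to the set of all input strings. Diagrams differing by permuting the boxes (carrying along strings and connections) are considered equal. $K[X]$ is the free $K$-vector space on closed diagrams, with product given by juxtaposition and unit the empty diagram. For $(n_1,\ldots,n_r)\in\mathbb{N}^r$ with $\sum_i n_ip_i=\sum_in_iq_i=n$ and $\sigma\in S_n$, the basic invariant $p(n,\sigma,n_1,\ldots,n_r)$ is the diagram with $n_1$ boxes $x_1$, then $n_2$ boxes $x_2$, ..., then $n_r$ boxes $x_r$, whose output strings and input strings are each numbered $1,\ldots,n$ from left to right, and where output string $j$ is connected to input string $\sigma(j)$. Every closed diagram is of this form, so the basic invariants (up to equality) form a basis of $K[X]$. $K[X]$ is $\mathbb{N}^r$-graded, with $p(n,\sigma,n_1,\ldots,n_r)$ of degree $(n_1,\ldots,n_r)$. $K[X]$ is a polynomial algebra on the connected diagrams, and $\Delta,\epsilon$ are the algebra maps for which each connected diagram $p$ is primitive: $\Delta(p)=p\otimes1+1\otimes p$, $\epsilon(p)=0$.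 **The inner product.** Different multidegrees are orthogonal, and on degree $(n_1,\ldots,n_r)$ $$\langle p(n,\sigma,n_1,\ldots,n_r),p(n,\tau,n_1,\ldots,n_r)\rangle=\big|\{g\in S_{n_1}\times\cdots\times S_{n_r}\ :\ \alpha_1(g)\sigma\alpha_2(g^{-1})=\tau\}\big|,$$ where $\alpha_1=\alpha^{(q_i)}_{(n_i)}$ and $\alpha_2=\alpha^{(p_i)}_{(n_i)}$ are the homomorphisms $S_{n_1}\times\cdots\times S_{n_r}\to S_n$ defined as follows: divide $\{1,\ldots,n\}$ into consecutive intervals of lengths $n_1p_1,\ldots,n_rp_r$, and divide the $i$-th interval into $n_i$ consecutive blocks of size $p_i$; $\alpha^{(p_i)}_{(n_i)}((\sigma_i))$ permutes the blocks of the $i$-th interval according to $\sigma_i$, keeping the order inside each block. $\alpha^{(q_i)}_{(n_i)}$ is the same with $q_i$ instead of $p_i$. **Rational PSH-algebra.** A rational ($K$-)PSH-algebra is an $\mathbb{N}^r$-graded $K$-Hopf algebra $A$ equipped with a graded basis $B$ (a union of bases of the homogeneous components) and a pairing $\langle-,-\rangle:A\otimes_KA\to K$ such that: (1) for all $x,y\in B$, $\langle x,y\rangle=\delta_{x,y}c(x)$ for some positive rational number $c(x)$; (2) multiplication is adjoint to comultiplication, i.e. $\langle a\otimes b,\Delta(c)\rangle=\langle ab,c\rangle$, where $A\otimes_KA$ has the tensor product pairing; (3) the unit $u:K\to A$ and counit $\epsilon:A\to K$ are adjoint, where $K$ has the canonical pairing; (4) $A$ is connected: $A_0=K$; (5)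 all the structure constants of the multiplication, $\Delta$, $u$, $\epsilon$ with respect to $B$ are nonnegative rational numbers. *)

(* Defs.v *)
From HB Require Import structures.
From mathcomp Require Import all_boot all_order all_fingroup all_algebra.
From mathcomp Require Import generic_quotient boolp classical_sets.
From mathcomp.multinomials Require Import monalg.

Set Implicit Arguments.
Unset Strict Implicit.
Unset Printing Implicit Defensive.

Import GRing.Theory.
Local Open Scope ring_scope.
Local Open Scope quotient_scope.

(* A tensor is represented by a formal sum of pure tensors, i.e. a sequence of
   pairs. Two formal sums are identified when no bilinear map separates them. *)
Section Tensor.
Variables (K : fieldType) (U V : lmodType K).

Definition bilinear_eval (W : lmodType K) (f : U -> V -> W) (s : seq (U * V)) : W :=
  \sum_(x <- s) f x.1 x.2.

Definition tensor_eqv (s t : seq (U * V)) : bool :=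
  `[< forall (W : lmodType K) (f : {bilinear U -> V -> W}),
        bilinear_eval f s = bilinear_eval f t >].

Lemma tensor_eqv_equiv : equiv_class_of tensor_eqv.
Proof.
split=> [s|s t|t s u].
- exact/asboolP.
- by apply/asboolP/asboolP => h W f; rewrite h.
- by move=> /asboolP h1 /asboolP h2; apply/asboolP => W f; rewrite h1 h2.
Qed.

Canonical tensor_eqv_equivRel := EquivRelPack tensor_eqv_equiv.

Definition tensor := {eq_quot tensor_eqv}.

HB.instance Definition _ := Choice.on tensor.
HB.instance Definition _ := EqQuotient.on tensor.

Definition tlift (W : lmodType K) (f : U -> V -> W) (t : tensor) : W :=
  bilinear_eval f (repr t).

Definition tens (u : U) (v : V) : tensor := \pi_tensor [:: (u, v)].

Lemma tlift_pi (W : lmodType K) (f : {bilinear U -> V -> W}) s :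
  tlift f (\pi_tensor s) = bilinear_eval f s.
Proof.
rewrite /tlift; have /eqmodP/asboolP : \pi_tensor (repr (\pi_tensor s)) = \pi_tensor s.
  exact: reprK.
exact.
Qed.

Lemma tensorP (s t : tensor) :
  (forall (W : lmodType K) (f : {bilinear U -> V -> W}), tlift f s = tlift f t) ->
  s = t.
Proof.
by move=> h; rewrite -[s]reprK -[t]reprK; apply/eqmodP/asboolP => W f; exact: h.
Qed.

Definition tensor_zero : tensor := \pi_tensor [::].
Definition tensor_add (s t : tensor) : tensor := \pi_tensor (repr s ++ repr t).
Definition tensor_scale (a : K) (t : tensor) : tensor :=
  \pi_tensor [seq (a *: x.1, x.2) | x <- repr t].
Definition tensor_opp (t : tensor) : tensor := tensor_scale (-1) t.

Let tlift0 (W : lmodType K) (f : {bilinear U -> V -> W}) : tlift f tensor_zero = 0.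
Proof. by rewrite tlift_pi /bilinear_eval big_nil. Qed.

Let tliftD (W : lmodType K) (f : {bilinear U -> V -> W}) s t :
  tlift f (tensor_add s t) = tlift f s + tlift f t.
Proof. by rewrite tlift_pi /bilinear_eval big_cat. Qed.

Let tliftZ (W : lmodType K) (f : {bilinear U -> V -> W}) a t :
  tlift f (tensor_scale a t) = a *: tlift f t.
Proof.
rewrite tlift_pi /bilinear_eval big_map scaler_sumr.
by apply: eq_bigr => x _ /=; rewrite linearZl_LR.
Qed.

Let tensor_addA : associative tensor_add.
Proof. by move=> x y z; apply: tensorP => W f; rewrite !tliftD addrA. Qed.
Let tensor_addC : commutative tensor_add.
Proof. by move=> x y; apply: tensorP => W f; rewrite !tliftD addrC. Qed.
Let tensor_add0 : left_id tensor_zero tensor_add.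
Proof. by move=> x; apply: tensorP => W f; rewrite tliftD tlift0 add0r. Qed.
Let tensor_addN : left_inverse tensor_zero tensor_opp tensor_add.
Proof.
by move=> x; apply: tensorP => W f; rewrite tliftD tliftZ tlift0 scaleN1r addNr.
Qed.

HB.instance Definition _ := GRing.isZmodule.Build tensor
  tensor_addA tensor_addC tensor_add0 tensor_addN.

Let tensor_scaleA a b t : tensor_scale a (tensor_scale b t) = tensor_scale (a * b) t.
Proof. by apply: tensorP => W f; rewrite !tliftZ scalerA. Qed.
Let tensor_scale1 : left_id 1 tensor_scale.
Proof. by move=> t; apply: tensorP => W f; rewrite tliftZ scale1r. Qed.
Let tensor_scaleDr : right_distributive tensor_scale +%R.
Proof.
by move=> a s t; apply: tensorP => W f; rewrite tliftZ !tliftD !tliftZ scalerDr.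
Qed.
Let tensor_scaleDl t : {morph tensor_scale^~ t : a b / a + b}.
Proof. by move=> a b; apply: tensorP => W f; rewrite tliftD !tliftZ scalerDl. Qed.

HB.instance Definition _ := GRing.Zmodule_isLmodule.Build K tensor
  tensor_scaleA tensor_scale1 tensor_scaleDr tensor_scaleDl.

Lemma tens_is_bilinear : bilinear_for *:%R *:%R tens.
Proof.
split=> [v a u u'|u a v v'] /=; apply: tensorP => W f;
  rewrite tliftD tliftZ !tlift_pi /bilinear_eval !big_seq1 /=.
- exact: linearPl.
- exact: linearPr.
Qed.

HB.instance Definition _ := bilinear_isBilinear.Build K U V tensor *:%R *:%R
  tens tens_is_bilinear.

Lemma tlift_is_linear (W : lmodType K) (f : {bilinear U -> V -> W}) : linear (tlift f).
Proof. by move=> a s t; rewrite tliftD tliftZ. Qed.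

Lemma tlift_tens (W : lmodType K) (f : {bilinear U -> V -> W}) u v :
  tlift f (tens u v) = f u v.
Proof. by rewrite tlift_pi /bilinear_eval big_seq1. Qed.

Lemma tensor_sum_tens (t : tensor) : t = \sum_(x <- repr t) tens x.1 x.2.
Proof.
apply: tensorP => W f.
pose g := GRing.isLinear.Build K tensor W *:%R (tlift f) (tlift_is_linear f).
pose F : {linear tensor -> W} := HB.pack (tlift f) g.
rewrite -[RHS]/(F _) linear_sum /=.
by apply: eq_bigr => x _; rewrite tlift_tens.
Qed.

End Tensor.

Notation "u ⊗ v" := (tens u v) (at level 40, left associativity).

Section Bases.
Variables (K : fieldType) (V : lmodType K).
Implicit Types S W : set V.

Definition lspan S : set V := (fun v : V =>
  exists (s : seq V) (c : V -> K),
    (forall x, x \in s -> S x) /\ v = \sum_(x <- s) c x *: x).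

Definition lin_indep S : Prop :=
  forall s : seq V, uniq s -> (forall x, x \in s -> S x) ->
  forall c : V -> K, \sum_(x <- s) c x *: x = 0 -> forall x, x \in s -> c x = 0.

Definition is_basis W S : Prop := lin_indep S /\ lspan S = W.

(* For S linearly independent, the coefficients c are the coordinates of v. *)
Definition nonneg_rat_comb S : set V := (fun v : V =>
  exists (s : seq V) (c : V -> rat),
    [/\ uniq s, forall x, x \in s -> S x, forall x, 0 <= c x
      & v = \sum_(x <- s) ratr (c x) *: x]).

End Bases.

Section PSH.
Variables (K : fieldType) (r : nat) (A : algType K).

Notation deg := {ffun 'I_r -> nat}.
Notation AA := (tensor A A).

Definition tensor_mul (s t : AA) : AA :=
  tlift (fun a b => tlift (fun c d => (a * c) ⊗ (b * d)) t) s.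

Definition tensor_form (form : A -> A -> K) (s t : AA) : K :=
  tlift (fun a b => tlift (fun c d => form a c * form b d : K^o) t) s.

Definition tensor_assoc (t : tensor AA A) : tensor A AA :=
  tlift (fun s c => tlift (fun a b => a ⊗ (b ⊗ c)) s) t.

Record is_graded_algebra (comp : deg -> set A) : Prop := {
  comp_submod : forall d, comp d 0 /\
    forall (k : K) a b, comp d a -> comp d b -> comp d (k *: a + b);
  comp_sum : forall a, exists (s : seq deg) (a_ : deg -> A),
    (forall d, comp d (a_ d)) /\ a = \sum_(d <- s) a_ d;
  comp_direct : forall (s : seq deg) (a_ : deg -> A),
    uniq s -> (forall d, comp d (a_ d)) -> \sum_(d <- s) a_ d = 0 ->
    forall d, d \in s -> a_ d = 0;
  comp_one : comp 0 1;
  comp_mul : forall d e a b, comp d a -> comp e b -> comp (d + e) (a * b)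
}.

Definition tensor_comp (comp : deg -> set A) (d : deg) : set AA :=
  lspan (fun t : AA => exists d1 d2 a b,
    [/\ d = d1 + d2, comp d1 a, comp d2 b & t = a ⊗ b]).

Definition is_algebra_map_to_tensor (Delta : {linear A -> AA}) : Prop :=
  Delta 1 = 1 ⊗ 1 /\ forall a b, Delta (a * b) = tensor_mul (Delta a) (Delta b).

Definition is_algebra_map_to_field (eps : {scalar A}) : Prop :=
  eps 1 = 1 /\ forall a b, eps (a * b) = eps a * eps b.

Definition is_antipode (Delta : {linear A -> AA}) (eps : {scalar A})
    (S : {linear A -> A}) : Prop :=
  forall a, tlift (fun x y => S x * y) (Delta a) = (eps a)%:A /\
            tlift (fun x y => x * S y) (Delta a) = (eps a)%:A.

Record is_graded_Hopf_algebra (comp : deg -> set A)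
    (Delta : {linear A -> AA}) (eps : {scalar A}) : Prop := {
  hopf_graded_algebra : is_graded_algebra comp;
  hopf_Delta_graded : forall d a, comp d a -> tensor_comp comp d (Delta a);
  hopf_eps_graded : forall d a, d != 0 -> comp d a -> eps a = 0;
  hopf_Delta_alg : is_algebra_map_to_tensor Delta;
  hopf_eps_alg : is_algebra_map_to_field eps;
  hopf_coassoc : forall a,
    tensor_assoc (tlift (fun x y => Delta x ⊗ y) (Delta a)) =
    tlift (fun x y => x ⊗ Delta y) (Delta a);
  hopf_counitl : forall a, tlift (fun x y => eps x *: y) (Delta a) = a;
  hopf_counitr : forall a, tlift (fun x y => eps y *: x) (Delta a) = a;
  hopf_antipode : exists S : {linear A -> A},
    is_antipode Delta eps S /\ forall d a, comp d a -> comp d (S a)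
}.

Record is_graded_basis (comp : deg -> set A) (B : set A) : Prop := {
  basis_homogeneous : forall b, B b -> exists d, comp d b;
  basis_comp : forall d, is_basis (comp d) (fun b => B b /\ comp d b)
}.

Record is_rational_PSH_algebra (comp : deg -> set A)
    (Delta : {linear A -> AA}) (eps : {scalar A})
    (B : set A) (form : {biscalar A}) : Prop := {
  PSH_Hopf : is_graded_Hopf_algebra comp Delta eps;
  PSH_basis : is_graded_basis comp B;
  PSH_orthogonal : exists c : A -> rat, forall x y, B x -> B y ->
    0 < c x /\ form x y = if x == y then ratr (c x) else 0;
  PSH_mul_adjoint : forall a b c,
    tensor_form form (a ⊗ b) (Delta c) = form (a * b) c;
  PSH_unit_adjoint : forall (k : K) a, form k%:A a = k * eps a;
  PSH_connected : forall a, comp 0 a <-> exists k : K, a = k%:A;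
  PSH_nonneg_mul : forall x y, B x -> B y -> nonneg_rat_comb B (x * y);
  PSH_nonneg_Delta : forall x, B x ->
    nonneg_rat_comb
      (fun t : AA => exists y z, [/\ B y, B z & t = y ⊗ z]) (Delta x);
  PSH_nonneg_unit : nonneg_rat_comb B 1;
  PSH_nonneg_eps : forall x, B x -> exists2 c : rat, 0 <= c & eps x = ratr c
}.

End PSH.

Section Diagrams.
Local Open Scope nat_scope.
Variables (r : nat) (p q : 'I_r -> nat).

(* A diagram, with a chosen order of its boxes, is given by the labels of its
   boxes and by the sequence of the numbers of the input strings to which the
   output strings 0, 1, ... are connected. Output and input strings are numbered
   from left to right: output string k of box b is the output string number
   flatten_index (map p s) b k, where s is the sequence of labels. *)
Definition prediagram_spec (d : seq 'I_r * seq nat) : bool :=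
  (size d.2 == sumn (map p d.1)) && perm_eq d.2 (iota 0 (sumn (map q d.1))).

Definition prediagram := {d : seq 'I_r * seq nat | prediagram_spec d}.

HB.instance Definition _ := Choice.on prediagram.

Definition boxes (d : prediagram) : seq 'I_r := (val d).1.
Definition conn (d : prediagram) : seq nat := (val d).2.
Definition label (d : prediagram) (b : 'I_(size (boxes d))) : 'I_r :=
  tnth (in_tuple (boxes d)) b.

(* Output string k of box b is connected to input string l of box b'. *)
Definition linked (d : prediagram) (b k b' l : nat) : bool :=
  [&& k < nth 0 (map p (boxes d)) b, l < nth 0 (map q (boxes d)) b'
    & nth 0 (conn d) (flatten_index (map p (boxes d)) b k)
        == flatten_index (map q (boxes d)) b' l].

Definition diagram_iso (d d' : prediagram)
    (phi : 'I_(size (boxes d)) -> 'I_(size (boxes d'))) : Prop :=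
  [/\ bijective phi, forall b, label (phi b) = label b
    & forall b k b' l, linked d' (phi b) k (phi b') l = linked d b k b' l].

Definition diagram_eqv (d d' : prediagram) : bool :=
  `[< exists phi, @diagram_iso d d' phi >].

Lemma diagram_eqv_equiv : equiv_class_of diagram_eqv.
Proof.
have sym d d' : diagram_eqv d d' -> diagram_eqv d' d.
  move=> /asboolP[phi [[psi phiK psiK] lab lnk]]; apply/asboolP.
  exists psi; split; first by exists phi.
  - by move=> b; rewrite -lab psiK.
  - by move=> b k b' l; rewrite -lnk !psiK.
split=> [d|d d'|d' d d''].
- by apply/asboolP; exists id; split=> //; exists id.
- by apply/idP/idP; apply: sym.
- move=> /asboolP[phi [bij lab lnk]] /asboolP[phi' [bij' lab' lnk']].
  apply/asboolP; exists (phi' \o phi); split; first exact: bij_comp.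
  + by move=> b /=; rewrite lab' lab.
  + by move=> b k b' l /=; rewrite lnk' lnk.
Qed.

Canonical diagram_eqv_equivRel := EquivRelPack diagram_eqv_equiv.

Definition diagram := {eq_quot diagram_eqv}.

HB.instance Definition _ := Choice.on diagram.
HB.instance Definition _ := EqQuotient.on diagram.

Definition adjacent (d : prediagram) (b b' : 'I_(size (boxes d))) : bool :=
  [exists k : 'I_(p (label b)), exists l : 'I_(q (label b')), linked d b k b' l].

Definition connected_diagram (d : prediagram) : bool :=
  (0 < size (boxes d)) &&
  [forall b, forall b', connect (relU (@adjacent d) (fun x y => adjacent y x)) b b'].

Lemma empty_spec : prediagram_spec ([::], [::]).
Proof. by []. Qed.

Definition empty_prediagram : prediagram := Sub ([::], [::]) empty_spec.

Lemma juxt_spec (d d' : prediagram) :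
  prediagram_spec (boxes d ++ boxes d',
    conn d ++ map (addn (sumn (map q (boxes d)))) (conn d')).
Proof.
have /andP[/eqP sc pc] := valP d; have /andP[/eqP sc' pc'] := valP d'.
rewrite /prediagram_spec /= !map_cat !sumn_cat size_cat size_map.
rewrite -sc -sc' eqxx /= iotaD perm_cat // add0n -[X in iota X]addn0 iotaDl.
exact: perm_map.
Qed.

Definition juxt (d d' : prediagram) : prediagram := Sub _ (juxt_spec d d').

Lemma nth_size_lt (u : 'I_r -> nat) (s : seq 'I_r) b k :
  k < nth 0 (map u s) b -> b < size s.
Proof.
by rewrite ltnNge; case: (ltnP b (size s)) => // h; rewrite nth_default // size_map.
Qed.

Lemma flatten_index_catl (u : 'I_r -> nat) (s s' : seq 'I_r) b k :
  b < size s -> flatten_index (map u (s ++ s')) b k = flatten_index (map u s) b k.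
Proof. by move=> h; rewrite /flatten_index map_cat take_cat size_map h. Qed.

Lemma flatten_index_catr (u : 'I_r -> nat) (s s' : seq 'I_r) b k :
  flatten_index (map u (s ++ s')) (size s + b) k =
  sumn (map u s) + flatten_index (map u s') b k.
Proof.
rewrite /flatten_index map_cat take_cat size_map ltnNge leq_addr /= addKn.
by rewrite sumn_cat addnA.
Qed.

Lemma nth_map_catl (u : 'I_r -> nat) (s s' : seq 'I_r) b :
  b < size s -> nth 0 (map u (s ++ s')) b = nth 0 (map u s) b.
Proof. by move=> h; rewrite map_cat nth_cat size_map h. Qed.

Lemma nth_map_catr (u : 'I_r -> nat) (s s' : seq 'I_r) b :
  nth 0 (map u (s ++ s')) (size s + b) = nth 0 (map u s') b.
Proof. by rewrite map_cat nth_cat size_map ltnNge leq_addr /= addKn. Qed.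

Lemma size_conn (d : prediagram) : size (conn d) = sumn (map p (boxes d)).
Proof. by have /andP[/eqP] := valP d. Qed.

Lemma conn_lt (d : prediagram) i :
  i < size (conn d) -> nth 0 (conn d) i < sumn (map q (boxes d)).
Proof.
by have /andP[_ /perm_mem hc] := valP d; move=> /(mem_nth 0); rewrite hc mem_iota.
Qed.

Lemma ltn_addF a b : (a + b < a) = false.
Proof. by rewrite ltnNge leq_addr. Qed.

Section Juxt.
Variables d d' : prediagram.
Let m := size (boxes d).

Lemma linked_juxtll b k b' l : b < m -> b' < m ->
  linked (juxt d d') b k b' l = linked d b k b' l.
Proof.
move=> hb hb'; rewrite /linked !nth_map_catl // !flatten_index_catl //.
have [hk|//] := boolP (k < _).
by rewrite /conn /= nth_cat -/(conn d) size_conn flatten_indexP.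
Qed.

Lemma linked_juxtrr b k b' l :
  linked (juxt d d') (m + b) k (m + b') l = linked d' b k b' l.
Proof.
rewrite /linked !nth_map_catr !flatten_index_catr.
have [hk|//] := boolP (k < _).
rewrite /conn /= nth_cat -/(conn d) -/(conn d') size_conn ltn_addF addKn.
by rewrite (nth_map 0) ?eqn_add2l // size_conn flatten_indexP.
Qed.

Lemma linked_juxtlr b k b' l : b < m -> linked (juxt d d') b k (m + b') l = false.
Proof.
move=> hb; rewrite /linked nth_map_catl // nth_map_catr.
rewrite flatten_index_catl // flatten_index_catr.
have [hk /=|//] := boolP (k < _); apply/negbTE/negP => /andP[_ /eqP].
have hi := flatten_indexP hk; rewrite /conn /= nth_cat -/(conn d) size_conn hi => e.
have := @conn_lt d (flatten_index (map p (boxes d)) b k).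
by rewrite size_conn e ltn_addF => /(_ hi).
Qed.

Lemma linked_juxtrl b k b' l : b' < m -> linked (juxt d d') (m + b) k b' l = false.
Proof.
move=> hb; rewrite /linked nth_map_catr nth_map_catl //.
rewrite flatten_index_catr flatten_index_catl //.
have [hk|//] := boolP (k < _); have [hl|//] := boolP (l < _).
rewrite /conn /= nth_cat -/(conn d) -/(conn d') size_conn ltn_addF addKn.
rewrite (nth_map 0) ?size_conn ?flatten_indexP //=; apply/negbTE/negP => /eqP e.
by have := flatten_indexP hl; rewrite -e ltn_addF.
Qed.

End Juxt.

Lemma diagram_eqv_nat (d d' : prediagram) (f g : nat -> nat) :
  (forall b, b < size (boxes d) -> f b < size (boxes d') /\ g (f b) = b) ->
  (forall b, b < size (boxes d') -> g b < size (boxes d) /\ f (g b) = b) ->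
  (forall x b, b < size (boxes d) -> nth x (boxes d') (f b) = nth x (boxes d) b) ->
  (forall b k b' l, b < size (boxes d) -> b' < size (boxes d) ->
     linked d' (f b) k (f b') l = linked d b k b' l) ->
  diagram_eqv d d'.
Proof.
move=> hf hg lab lnk; apply/asboolP.
exists (fun b : 'I__ => Ordinal (hf b (ltn_ord b)).1); split=> [|b|b k b' l].
- exists (fun b : 'I__ => Ordinal (hg b (ltn_ord b)).1) => b; apply: val_inj => /=.
  + exact: (hf b (ltn_ord b)).2.
  + exact: (hg b (ltn_ord b)).2.
- by rewrite /label !(tnth_nth (label b)) lab.
- exact: lnk.
Qed.

Lemma diagram_eqvP (d d' : prediagram) : diagram_eqv d d' ->
  exists f g : nat -> nat,
  [/\ forall b, b < size (boxes d) -> f b < size (boxes d') /\ g (f b) = b,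
      forall b, b < size (boxes d') -> g b < size (boxes d) /\ f (g b) = b,
      forall x b, b < size (boxes d) -> nth x (boxes d') (f b) = nth x (boxes d) b
    & forall b k b' l, b < size (boxes d) -> b' < size (boxes d) ->
        linked d' (f b) k (f b') l = linked d b k b' l].
Proof.
move=> /asboolP[phi [[psi phiK psiK] lab lnk]].
pose ext m n (h : 'I_m -> 'I_n) b := if insub b is Some b' then val (h b') else 0.
have extE m n (h : 'I_m -> 'I_n) b (lt_b : b < m) : ext m n h b = h (Ordinal lt_b).
  by rewrite /ext insubT.
have extO m n (h : 'I_m -> 'I_n) (b : 'I_m) : ext m n h b = h b.
  by rewrite extE; congr (val (h _)); apply: val_inj.
exists (ext _ _ phi), (ext _ _ psi); split=> [b hb|b hb|x b hb|b k b' l hb hb'].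
- by rewrite extE extO phiK.
- by rewrite extE extO psiK.
- by have := lab (Ordinal hb); rewrite /label !(tnth_nth x) extE.
- by rewrite !extE lnk.
Qed.

Lemma juxtC (d d' : prediagram) : diagram_eqv (juxt d d') (juxt d' d).
Proof.
pose sw m n b := if b < m then n + b else b - m.
have sw1 m n b : b < m -> sw m n b = n + b by rewrite /sw => ->.
have sw2 m n b : sw m n (m + b) = b by rewrite /sw ltn_addF addKn.
have swP m n b : b < m + n -> sw m n b < n + m /\ sw n m (sw m n b) = b.
  have [hb _|hb] := ltnP b m; first by rewrite sw1 // ltn_add2l sw2.
  rewrite -(subnKC hb) ltn_add2l sw2 => hj.
  by rewrite sw1 // ltn_addr.
set m := size (boxes d); set n := size (boxes d').
have sz : size (boxes (juxt d d')) = m + n by rewrite size_cat.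
have sz' : size (boxes (juxt d' d)) = n + m by rewrite size_cat.
apply: (diagram_eqv_nat (f := sw m n) (g := sw n m)); rewrite ?sz ?sz'.
- exact: swP.
- exact: swP.
- move=> x b hb; rewrite /boxes /= !nth_cat -/(boxes d) -/(boxes d') -/m -/n.
  have [lt_b|le_b] := ltnP b m; first by rewrite sw1 // ltn_addF addKn.
  by move: hb; rewrite -(subnKC le_b) ltn_add2l sw2 addKn => ->.
- move=> b k b' l; have [lt_b|le_b] := ltnP b m; have [lt_b'|le_b'] := ltnP b' m.
  + by rewrite !sw1 // linked_juxtrr linked_juxtll.
  + rewrite -(subnKC le_b') !ltn_add2l sw1 // sw2 => _ hb'.
    by rewrite linked_juxtlr // linked_juxtrl.
  + rewrite -(subnKC le_b) !ltn_add2l [sw _ _ b']sw1 // sw2 => hb _.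
    by rewrite linked_juxtlr // linked_juxtrl.
  + rewrite -(subnKC le_b) -(subnKC le_b') !ltn_add2l !sw2 => hb hb'.
    by rewrite linked_juxtrr linked_juxtll.
Qed.

Lemma juxt_eqvl (d1 d2 e : prediagram) :
  diagram_eqv d1 d2 -> diagram_eqv (juxt d1 e) (juxt d2 e).
Proof.
move=> /diagram_eqvP[f [g [hf hg lab lnk]]].
pose ex (h : nat -> nat) m n b := if b < m then h b else n + (b - m).
have ex1 h m n b : b < m -> ex h m n b = h b by rewrite /ex => ->.
have ex2 h m n b : ex h m n (m + b) = n + b by rewrite /ex ltn_addF addKn.
set m1 := size (boxes d1) in hf hg lab lnk; set m2 := size (boxes d2) in hf hg.
set n := size (boxes e).
have exP (h h' : nat -> nat) m m' : (forall b, b < m -> h b < m' /\ h' (h b) = b) ->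
    forall b, b < m + n ->
    ex h m m' b < m' + n /\ ex h' m' m (ex h m m' b) = b.
  move=> hh b; have [lt_b _|le_b] := ltnP b m.
    by have [h1 h2] := hh _ lt_b; rewrite ex1 // ltn_addr // ex1.
  by rewrite -(subnKC le_b) ltn_add2l ex2 ltn_add2l ex2.
have sz1 : size (boxes (juxt d1 e)) = m1 + n by rewrite size_cat.
have sz2 : size (boxes (juxt d2 e)) = m2 + n by rewrite size_cat.
apply: (diagram_eqv_nat (f := ex f m1 m2) (g := ex g m2 m1)); rewrite ?sz1 ?sz2.
- exact: exP.
- exact: exP.
- move=> x b hb.
  rewrite /boxes /= !nth_cat -/(boxes d1) -/(boxes d2) -/(boxes e) -/m1 -/m2.
  have [lt_b|le_b] := ltnP b m1; first by rewrite ex1 // (hf _ lt_b).1 lab.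
  by rewrite -(subnKC le_b) ex2 ltn_addF !addKn.
- move=> b k b' l; have [lt_b|le_b] := ltnP b m1; have [lt_b'|le_b'] := ltnP b' m1.
  + by have [h _] := hf _ lt_b; have [h' _] := hf _ lt_b';
      rewrite !ex1 // !linked_juxtll // lnk.
  + rewrite -(subnKC le_b') ex1 // ex2 => _ _.
    by rewrite !linked_juxtlr //; case: (hf b).
  + rewrite -(subnKC le_b) [ex _ _ _ b']ex1 // ex2 => _ _.
    by rewrite !linked_juxtrl //; case: (hf b').
  + by rewrite -(subnKC le_b) -(subnKC le_b') !ex2 !linked_juxtrr.
Qed.

Definition dmul (D D' : diagram) : diagram := \pi_diagram (juxt (repr D) (repr D')).
Definition dunit : diagram := \pi_diagram empty_prediagram.

Lemma pi_juxt (d d' : prediagram) :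
  dmul (\pi_diagram d) (\pi_diagram d') = \pi_diagram (juxt d d').
Proof.
have repr_eqv e : diagram_eqv (repr (\pi_diagram e)) e by apply/eqmodP; rewrite reprK.
have piE d1 d2 : diagram_eqv d1 d2 -> \pi_diagram d1 = \pi_diagram d2 by move/eqmodP.
rewrite /dmul (piE _ _ (juxt_eqvl (repr (\pi_diagram d')) (repr_eqv d))).
rewrite (piE _ _ (juxtC _ _)) (piE _ _ (juxt_eqvl d (repr_eqv d'))).
exact: piE (juxtC _ _).
Qed.

Lemma dmulC : commutative dmul.
Proof. by move=> D D'; exact/eqmodP/juxtC. Qed.

Lemma dmulA : associative dmul.
Proof.
elim/quotW=> d1; elim/quotW=> d2; elim/quotW=> d3.
rewrite (pi_juxt d2 d3) (pi_juxt d1) (pi_juxt d1 d2) pi_juxt.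
congr (\pi_diagram _); apply: val_inj => /=; rewrite /conn /boxes /=.
rewrite catA map_cat catA -map_comp map_cat sumn_cat; congr (_, _ ++ _).
by apply: eq_map => i /=; rewrite addnA.
Qed.

Lemma dmul1 : left_id dunit dmul.
Proof.
elim/quotW=> d; rewrite pi_juxt; congr (\pi_diagram _); apply: val_inj.
by rewrite /= /conn /boxes /= map_id_in //; case: (val d).
Qed.

Lemma dmulr1 : right_id dunit dmul.
Proof. by move=> D; rewrite dmulC dmul1. Qed.

Lemma pi_eq_one (d : prediagram) : \pi_diagram d = dunit -> d = empty_prediagram.
Proof.
move=> /eqmodP/asboolP[phi _]; apply: val_inj => /=.
have bd : boxes d = [::].
  by case E : (boxes d) => [//|x s]; have := phi; rewrite E => /(_ ord0) [].
have := size_conn d; rewrite bd => /= /size0nil cd.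
by move: bd cd; rewrite /boxes /conn /=; case: (sval d) => s c /= -> ->.
Qed.

Lemma dmul_eq1 (D D' : diagram) : dmul D D' = dunit -> D = dunit /\ D' = dunit.
Proof.
move=> /pi_eq_one/(congr1 val) /= [/(congr1 size) + _].
rewrite size_cat => /eqP; rewrite addn_eq0 => /andP[/eqP/size0nil h /eqP/size0nil h'].
have emp E : boxes (repr E) = [::] -> E = dunit.
  move=> b; rewrite -[E]reprK; congr (\pi_diagram _); apply: val_inj => /=.
  have := size_conn (repr E); rewrite b => /= /size0nil c.
  by move: b c; rewrite /boxes /conn /=; case: (sval (repr E)) => s c /= -> ->.
by split; apply: emp.
Qed.

HB.instance Definition _ := Choice_isMonomialDef.Build diagram
  dmulA dmul1 dmulr1 dmul_eq1.
HB.instance Definition _ := MonomialDef_isConomialDef.Build diagram dmulC.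

Definition standard_boxes (n_ : {ffun 'I_r -> nat}) : seq 'I_r :=
  flatten [seq nseq (n_ i) i | i <- enum 'I_r].

Lemma sumn_standard_boxes (u : 'I_r -> nat) (n_ : {ffun 'I_r -> nat}) :
  sumn (map u (standard_boxes n_)) = \sum_(i < r) n_ i * u i.
Proof.
rewrite /standard_boxes -big_enum /=; elim: (enum 'I_r) => [|i e IHe] /=.
  by rewrite big_nil.
by rewrite big_cons map_cat sumn_cat IHe map_nseq sumn_nseq mulnC.
Qed.

Section BasicInvariant.
Variables (n_ : {ffun 'I_r -> nat}) (n : nat).
Hypotheses (hp : \sum_(i < r) n_ i * p i = n) (hq : \sum_(i < r) n_ i * q i = n).

Lemma basic_spec (sigma : 'S_n) :
  prediagram_spec (standard_boxes n_, [seq val (sigma j) | j <- enum 'I_n]).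
Proof.
rewrite /prediagram_spec /= !sumn_standard_boxes hp hq size_map size_enum_ord eqxx.
rewrite -val_enum_ord (map_comp val sigma) perm_map // uniq_perm ?enum_uniq //.
  by rewrite map_inj_uniq ?enum_uniq //; apply: perm_inj.
move=> i; rewrite mem_enum; apply/mapP; exists (sigma^-1%g i); first exact: mem_enum.
by rewrite permKV.
Qed.

Definition basic_prediagram (sigma : 'S_n) : prediagram :=
  Sub (standard_boxes n_, [seq val (sigma j) | j <- enum 'I_n]) (basic_spec sigma).

End BasicInvariant.
End Diagrams.

Section BlockPerm.
Local Open Scope nat_scope.
Variables (r : nat) (u : 'I_r -> nat) (n_ : {ffun 'I_r -> nat}) (n : nat).
Hypothesis hn : \sum_(i < r) n_ i * u i = n.
Notation G := {dffun forall i : 'I_r, 'S_(n_ i)}.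

Let lens := [seq n_ i * u i | i <- enum 'I_r].

Definition block_pos (i : 'I_r) (a : 'I_(n_ i)) (k : nat) : nat :=
  flatten_index lens i (a * u i + k).

Definition block_fun (g : G) (j : nat) : nat :=
  if insub (reshape_index lens j) is Some i then
    if insub (reshape_offset lens j %/ u i) is Some a then
      block_pos (g i a) (reshape_offset lens j %% u i)
    else j
  else j.

Let nth_lens (i : 'I_r) : nth 0 lens i = n_ i * u i.
Proof. by rewrite (nth_map i) ?size_enum_ord // nth_ord_enum. Qed.

Let sumn_lens : sumn lens = n.
Proof. by rewrite -hn sumnE big_map -big_enum. Qed.

Let pos_lt (i : 'I_r) (a : 'I_(n_ i)) k : k < u i -> a * u i + k < nth 0 lens i.
Proof.
by move=> hk; rewrite nth_lens -ltn_subRL (leq_trans hk) // -mulnBl leq_pmull ?subn_gt0.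
Qed.

Lemma block_pos_lt (i : 'I_r) (a : 'I_(n_ i)) k : k < u i -> block_pos a k < n.
Proof. by move=> hk; rewrite -sumn_lens flatten_indexP ?pos_lt. Qed.

Lemma block_posP j : j < n ->
  exists (i : 'I_r) (a : 'I_(n_ i)) (k : nat), k < u i /\ j = block_pos a k.
Proof.
rewrite -sumn_lens => hj.
have [i ei] : exists i : 'I_r, val i = reshape_index lens j.
  have hi : reshape_index lens j < r.
    by have := reshape_indexP hj; rewrite size_map size_enum_ord.
  by exists (Ordinal hi).
have := reshape_offsetP hj; rewrite -ei nth_lens => ho.
have u0 : 0 < u i by case: (u i) ho => //; rewrite muln0.
have ha : reshape_offset lens j %/ u i < n_ i by rewrite ltn_divLR.
exists i, (Ordinal ha), (reshape_offset lens j %% u i); split; first exact: ltn_pmod.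
by rewrite /block_pos /= -divn_eq [X in flatten_index _ X]ei reshape_indexK.
Qed.

Lemma block_funE (g : G) (i : 'I_r) (a : 'I_(n_ i)) k : k < u i ->
  block_fun g (block_pos a k) = block_pos (g i a) k.
Proof.
move=> hk; rewrite /block_fun /block_pos flatten_indexKl ?pos_lt //.
rewrite flatten_indexKr ?pos_lt // valK.
have u0 : 0 < u i by apply: leq_ltn_trans hk.
by rewrite divnMDl // divn_small // addn0 valK modnMDl modn_small.
Qed.

Lemma block_fun_lt (g : G) (j : 'I_n) : block_fun g j < n.
Proof.
by have [i [a [k [hk ->]]]] := block_posP (ltn_ord j); rewrite block_funE ?block_pos_lt.
Qed.

Lemma block_fun_inj (g : G) : injective (fun j : 'I_n => Ordinal (block_fun_lt g j)).
Proof.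
apply: can_inj (fun j : 'I_n => Ordinal (block_fun_lt g^-1%g j)) _ => j.
apply: val_inj => /=; have [i [a [k [hk ->]]]] := block_posP (ltn_ord j).
by rewrite !block_funE // ffunE permK.
Qed.

(* The homomorphism usually written alpha^(u_i)_(n_i). *)
Definition block_perm (g : G) : 'S_n := perm (@block_fun_inj g).

End BlockPerm.

Section KX.
Variables (K : fieldType) (r : nat) (p q : 'I_r -> nat).
Notation deg := {ffun 'I_r -> nat}.

Definition KX := {malg K[diagram p q]}.

HB.instance Definition _ := GRing.ComAlgebra.on KX.

Definition KX_diagram (d : prediagram p q) : KX := << \pi_(diagram p q) d >>.

Definition basic_invariant (n_ : deg) (n : nat)
    (hp : (\sum_(i < r) n_ i * p i = n)%N) (hq : (\sum_(i < r) n_ i * q i = n)%N)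
    (sigma : 'S_n) : KX := KX_diagram (basic_prediagram hp hq sigma).

Definition basic_invariants_of_degree (n_ : deg) : set KX := (fun x : KX =>
  exists n hp hq (sigma : 'S_n), x = @basic_invariant n_ n hp hq sigma).

Definition basic_invariants : set KX := (fun x : KX =>
  exists n_ : deg, basic_invariants_of_degree n_ x).

Definition KX_comp (n_ : deg) : set KX := lspan (basic_invariants_of_degree n_).

Definition is_KX_Delta (Delta : {linear KX -> tensor KX KX}) : Prop :=
  is_algebra_map_to_tensor Delta /\
  forall d, connected_diagram d ->
    Delta (KX_diagram d) = KX_diagram d ⊗ 1 + 1 ⊗ KX_diagram d.

Definition is_KX_eps (eps : {scalar KX}) : Prop :=
  is_algebra_map_to_field eps /\
  forall d, connected_diagram d -> eps (KX_diagram d) = 0.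

(* The condition is alpha_1(g) o sigma o alpha_2(g^-1) = tau (composition of
   functions), where alpha_1 permutes the input strings and alpha_2 the outputs. *)
Definition KX_transporter (n_ : deg) (n : nat)
    (hp : (\sum_(i < r) n_ i * p i = n)%N) (hq : (\sum_(i < r) n_ i * q i = n)%N)
    (sigma tau : 'S_n) : pred {dffun forall i : 'I_r, 'S_(n_ i)} :=
  [pred g | [forall j : 'I_n,
     block_perm hq g (sigma (block_perm hp g^-1%g j)) == tau j]].

Definition is_KX_form (form : {biscalar KX}) : Prop :=
  (forall (m_ n_ : deg) x y, m_ != n_ ->
     basic_invariants_of_degree m_ x -> basic_invariants_of_degree n_ y ->
     form x y = 0) /\
  (forall (n_ : deg) n hp hq (sigma tau : 'S_n),
     form (@basic_invariant n_ n hp hq sigma) (basic_invariant hp hq tau) =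
     #|KX_transporter hp hq sigma tau|%:R).

End KX.

(* Main.v *)
(** The coefficient of [A ⊗ B] in the coproduct of a closed diagram [D] is
    computed in two ways.  The coproduct is multiplicative and primitive on
    connected diagrams, so it is the sum of [D_S ⊗ D_S'] over all ways to
    cut [D] into two unlinked parts [S] and [S'].  An isomorphism from the
    juxtaposition [A B] to [D] is the same as such a cut together with
    isomorphisms [A ~ D_S] and [B ~ D_S'].  Hence that coefficient is
    [#Iso(A B, D) / (#Aut A * #Aut B)].  Since the form of the theorem is
    [<D, D'> = #Iso(D, D')], this says that multiplication and comultiplication
    are adjoint, and coassociativity and counitality are then dual to the
    associativity and the unit law of juxtaposition.  The antipode multiplies a
    diagram with [c] connected components by [(-1)^c], where [2^c] is the number
    of cuts. *)
Require Import Defs.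
From HB Require Import structures.
From mathcomp Require Import boolp classical_sets.
From mathcomp Require Import all_boot all_order all_fingroup all_algebra.
From mathcomp Require Import generic_quotient finmap ring.
From mathcomp.multinomials Require Import monalg.

Set Implicit Arguments.
Unset Strict Implicit.
Unset Printing Implicit Defensive.

Import GRing.Theory.
Local Open Scope ring_scope.
Local Open Scope quotient_scope.

(** * Nets, isomorphisms and cuts *)

Section Nets.
Local Open Scope nat_scope.
Variable r : nat.

(** A prediagram numbers its boxes and strings globally, so a subset of its boxes is not a
    prediagram before renumbering. Nets avoid this: the boxes form any finite type, a part is a
    subtype and a juxtaposition is a sum type. Isomorphisms and cuts are counted on nets; numbering
    returns only when a closed diagram has to be rebuilt from a net.

    The counting identities are multiplied out by the automorphism orders, so they hold between
    natural numbers. Division happens only in [K], where characteristic zero makes these orders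
    invertible.

    The theorem speaks of every [Delta] and [eps] with the prescribed properties. Explicit models
    are built on the basis of diagrams, and any such maps agree with the models because connected
    diagrams generate the monoid of diagrams. The Hopf part is therefore carried out for a
    commutative monoid with abstract automorphism orders and splittings. *)

Record net := Net {
  nbox : finType;
  nlab : nbox -> 'I_r;
  nlink : nbox -> nat -> nbox -> nat -> bool }.

Definition net_iso (N N' : net) (f : nbox N -> nbox N') : Prop :=
  [/\ bijective f, forall b, nlab (f b) = nlab b
    & forall b k b' l, nlink (f b) k (f b') l = nlink b k b' l].

Definition isom (N N' : net) : Prop := exists f, @net_iso N N' f.

Definition isos (N N' : net) : {set {ffun nbox N -> nbox N'}} :=
  [set f : {ffun nbox N -> nbox N'} | `[< net_iso f >]].

Definition niso (N N' : net) : nat := #|isos N N'|.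

Lemma isosP (N N' : net) (f : {ffun nbox N -> nbox N'}) :
  reflect (net_iso f) (f \in isos N N').
Proof. by rewrite inE; exact: asboolP. Qed.

Lemma inj_surj_bij (T T' : Type) (f : T -> T') :
  injective f -> (forall y, exists x, f x = y) -> bijective f.
Proof.
move=> fI fS; have [g gK] := boolp.choice fS.
by exists g => // x; apply: fI; rewrite gK.
Qed.

Lemma net_iso_ffun (N N' : net) (f : nbox N -> nbox N') :
  net_iso f -> finfun f \in isos N N'.
Proof.
move=> [bf lf kf]; apply/isosP; split.
- by apply: (eq_bij bf) => x; rewrite ffunE.
- by move=> b; rewrite ffunE.
- by move=> b k b' l; rewrite !ffunE.
Qed.

Lemma net_iso_comp (N N' N'' : net) (f : nbox N -> nbox N') (g : nbox N' -> nbox N'') :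
  net_iso f -> net_iso g -> net_iso (g \o f).
Proof.
move=> [bf lf kf] [bg lg kg]; split; first exact: bij_comp.
- by move=> b /=; rewrite lg.
- by move=> b k b' l /=; rewrite kg.
Qed.

Lemma net_iso_inv (N N' : net) (f : nbox N -> nbox N') (g : nbox N' -> nbox N) :
  cancel f g -> cancel g f -> net_iso f -> net_iso g.
Proof.
move=> fK gK [_ lf kf]; split; first by exists f.
- by move=> b; rewrite -lf gK.
- by move=> b k b' l; rewrite -kf !gK.
Qed.

Lemma isom_refl (N : net) : isom N N.
Proof. by exists id; split=> //; exists id. Qed.

Lemma isom_sym (N N' : net) : isom N N' -> isom N' N.
Proof.
by move=> [f fi]; have [[g fK gK] _ _] := fi; exists g; apply: net_iso_inv fi.
Qed.

Lemma isom_trans (N' N N'' : net) : isom N N' -> isom N' N'' -> isom N N''.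
Proof. by move=> [f fi] [g gi]; exists (g \o f); apply: net_iso_comp. Qed.

Lemma niso_gt0 (N N' : net) : isom N N' <-> 0 < niso N N'.
Proof.
split=> [[f /net_iso_ffun fi]|/card_gt0P[f /isosP fi]]; last by exists f.
by apply/card_gt0P; exists (finfun f).
Qed.

(** Composing with the given isomorphisms on both sides is injective, which gives one inequality;
    the inverse isomorphisms give the other. *)
Lemma niso_isom (N M N' M' : net) :
  isom N M -> isom N' M' -> niso N N' = niso M M'.
Proof.
have le (A B A' B' : net) : isom A B -> isom A' B' -> niso A A' <= niso B B'.
  move=> [h hi] [h' hi']; have [[g hK gK] _ _] := hi.
  pose F (f : {ffun nbox A -> nbox A'}) := [ffun x => h' (f (g x))].
  have FI : injective F.
    move=> f1 f2 /ffunP e; apply/ffunP => x; have := e (h x).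
    by rewrite !ffunE hK; case: hi' => /bij_inj inj _ _ /inj.
  rewrite /niso -(card_imset _ FI); apply/subset_leq_card/subsetP => _ /imsetP[f /isosP fi ->].
  have := net_iso_comp (net_iso_inv hK gK hi) (net_iso_comp fi hi').
  by move=> /net_iso_ffun.
by move=> i i'; apply/eqP; rewrite eqn_leq !le //; apply: isom_sym.
Qed.

Definition sum_net (A B : net) : net :=
  @Net (nbox A + nbox B)%type
    (fun x => match x with inl a => nlab a | inr b => nlab b end)
    (fun x k y l => match x, y with
       | inl a, inl a' => nlink a k a' l
       | inr b, inr b' => nlink b k b' l
       | _, _ => false end).

Lemma isom_sum (A B A' B' : net) :
  isom A A' -> isom B B' -> isom (sum_net A B) (sum_net A' B').
Proof.
move=> [f [[f' fK f'K] lf kf]] [g [[g' gK g'K] lg kg]].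
exists (fun x : nbox (sum_net A B) =>
  match x with inl a => inl (f a) | inr b => inr (g b) end).
split; last 2 first.
- by case.
- by case=> [a|b] k [a'|b'] l /=.
exists (fun x => match x with inl a => inl (f' a) | inr b => inr (g' b) end).
- by case=> [a|b] /=; rewrite ?fK ?gK.
- by case=> [a|b] /=; rewrite ?f'K ?g'K.
Qed.

(** A two-colouring of the boxes that is constant along links, hence on connected components. *)
Definition cut_spec (N : net) (f : {ffun nbox N -> bool}) : bool :=
  `[< forall b k b' l, nlink b k b' l -> f b = f b' >].

Definition cut (N : net) := {f : {ffun nbox N -> bool} | cut_spec f}.

HB.instance Definition _ N := Finite.on (cut N).

Definition side (N : net) (f : cut N) : nbox N -> bool := val f.

Lemma cut_link (N : net) (f : cut N) b k b' l : nlink b k b' l -> side f b = side f b'.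
Proof. by move: b k b' l; apply/asboolP/(valP f). Qed.

Lemma exists_cut (N : net) (g : nbox N -> bool) :
  (forall b k b' l, nlink b k b' l -> g b = g b') -> exists f : cut N, side f =1 g.
Proof.
move=> h; have hs : cut_spec (finfun g).
  by apply/asboolP => b k b' l; rewrite !ffunE; apply: h.
by exists (Sub (finfun g) hs) => b; rewrite /side SubK ffunE.
Qed.

Lemma side_inj (N : net) (f g : cut N) : side f =1 side g -> f = g.
Proof. by move=> h; apply/val_inj/ffunP. Qed.

(** The colouring is a bare function, not a cut, so that restrictions such as [f \o inl] can be used
    directly. *)
Definition part (N : net) (g : nbox N -> bool) (c : bool) : net :=
  @Net {x : nbox N | g x == c} (fun x => nlab (val x))
    (fun x k y l => nlink (val x) k (val y) l).

Lemma eq_part (N : net) (g g' : nbox N -> bool) c c' :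
  (forall b, (g b == c) = (g' b == c')) -> isom (part g c) (part g' c').
Proof.
move=> e; have h (x : nbox (part g c)) : g' (val x) == c' by rewrite -e (valP x).
have h' (x : nbox (part g' c')) : g (val x) == c by rewrite e (valP x).
exists (fun x : nbox (part g c) => (Sub (val x) (h x) : nbox (part g' c'))); split=> //.
by exists (fun x : nbox (part g' c') => (Sub (val x) (h' x) : nbox (part g c))) => x;
  apply: val_inj.
Qed.

Lemma part_sum (A B : net) (f : nbox (sum_net A B) -> bool) c :
  isom (part f c) (sum_net (part (f \o inl) c) (part (f \o inr) c)).
Proof.
apply: isom_sym; pose F (x : nbox (sum_net (part (f \o inl) c) (part (f \o inr) c))) :
  nbox (part f c) := match x with
    inl a => exist (fun y : nbox (sum_net A B) => f y == c) (inl (val a)) (valP a)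
  | inr b => exist (fun y : nbox (sum_net A B) => f y == c) (inr (val b)) (valP b) end.
exists F; split.
- apply: inj_surj_bij.
  + by case=> [a|b] [a'|b'] //= /(congr1 val) /= [] /val_inj ->.
  + by case=> -[a|b] h; [exists (inl (Sub a h))|exists (inr (Sub b h))]; apply: val_inj.
- by case.
- by case=> [a|b] k [a'|b'].
Qed.

(** * Isomorphisms out of a disjoint union *)

Section SumAdjoint.
Variables A B N : net.

Definition compat (phi : {ffun nbox (sum_net A B) -> nbox N}) (f : cut N) : bool :=
  [forall x, side f (phi x) == if x is inl _ then true else false].

Definition glue (f : cut N)
    (ab : {ffun nbox A -> nbox (part (side f) true)} *
          {ffun nbox B -> nbox (part (side f) false)}) :
    {ffun nbox (sum_net A B) -> nbox N} :=
  [ffun x => match x with inl a => val (ab.1 a) | inr b => val (ab.2 b) end].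

Lemma glue_inj f : injective (@glue f).
Proof.
move=> [a b] [a' b'] /ffunP e; congr (_, _); apply/ffunP => x; apply: val_inj.
- by have := e (inl x); rewrite !ffunE.
- by have := e (inr x); rewrite !ffunE.
Qed.

(** The colouring that tells the two summands apart is carried over to [N] by the inverse of [phi].
    It is a cut because no link of a disjoint union joins the summands. *)
Lemma exists_compat phi : phi \in isos (sum_net A B) N ->
  exists f, forall f', compat phi f' = (f' == f).
Proof.
move=> /isosP[[psi phiK psiK] lab lnk].
pose isl (x : nbox (sum_net A B)) := if x is inl _ then true else false.
have [b k b' l|f ef] := @exists_cut N (isl \o psi).
  rewrite -{1}[b]psiK -{1}[b']psiK lnk /=.
  by case: (psi b) (psi b') => [?|?] [].
exists f => f'; apply/forallP/eqP => [h|-> x]; last by rewrite ef /= phiK.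
by apply: side_inj => b; have /eqP := h (psi b); rewrite psiK ef.
Qed.

(** The fibre over a fixed cut is a product: restricting an isomorphism to the summands inverts
    [glue]. That a glued map respects links across the summands holds because [f] forbids such links
    in [N]. *)
Lemma compat_isos f :
  [set phi in isos (sum_net A B) N | compat phi f] =
  [set glue ab | ab in setX (isos A (part (side f) true)) (isos B (part (side f) false))].
Proof.
apply/setP => phi; apply/setIdP/imsetP => [[/isosP[bij lab lnk] /forallP cmp]|].
- have ha a : side f (phi (inl a)) == true := cmp (inl a).
  have hb b : side f (phi (inr b)) == false := cmp (inr b).
  pose al := [ffun a => Sub (phi (inl a)) (ha a) : nbox (part (side f) true)].
  pose be := [ffun b => Sub (phi (inr b)) (hb b) : nbox (part (side f) false)].
  have phiI := bij_inj bij; have [psi phiK psiK] := bij.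
  exists (al, be); last first.
    by apply/ffunP => -[a|b]; rewrite !ffunE.
  rewrite in_setX /= !inE; apply/andP; split; apply/asboolP; split.
  + apply: inj_surj_bij => [a a'|y].
      by rewrite !ffunE => /(congr1 val) /phiI [].
    case e: (psi (val y)) (psiK (val y)) => [a|b] e'.
      by exists a; rewrite ffunE; apply: val_inj.
    by have := cmp (inr b); rewrite e' (eqP (valP y)).
  + by move=> a; rewrite ffunE /= lab.
  + by move=> a k a' l; rewrite !ffunE /= lnk.
  + apply: inj_surj_bij => [a a'|y].
      by rewrite !ffunE => /(congr1 val) /phiI [].
    case e: (psi (val y)) (psiK (val y)) => [a|b] e'.
      by have := cmp (inl a); rewrite e' (eqP (valP y)).
    by exists b; rewrite ffunE; apply: val_inj.
  + by move=> b; rewrite ffunE /= lab.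
  + by move=> b k b' l; rewrite !ffunE /= lnk.
- move=> [[al be]]; rewrite in_setX /= !inE => /andP[/asboolP[bA lA kA] /asboolP[bB lB kB]] ->.
  split; last by apply/forallP => -[a|b]; rewrite ffunE /=;
    [exact: (valP (al a))|exact: (valP (be b))].
  have alT a : side f (sval (al a)) = true by exact/eqP/(valP (al a)).
  have beF b : side f (sval (be b)) = false by exact/eqP/(valP (be b)).
  apply/asboolP; split.
  + apply: inj_surj_bij => [[a|b] [a'|b']|y]; rewrite ?ffunE //=.
    * by move/val_inj/(bij_inj bA) ->.
    * by move/(congr1 (side f)); rewrite alT beF.
    * by move/(congr1 (side f)); rewrite alT beF.
    * by move/val_inj/(bij_inj bB) ->.
    * case e: (side f y).
        have [g _ gK] := bA; exists (inl (g (Sub y (introT eqP e)))).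
        by rewrite ffunE gK.
      have [g _ gK] := bB; exists (inr (g (Sub y (introT eqP e)))).
      by rewrite ffunE gK.
  + by case=> [a|b]; rewrite ffunE /=; [exact: lA|exact: lB].
  + case=> [a|b] k [a'|b'] l; rewrite !ffunE /=; [exact: kA| | |exact: kB].
    * by apply/negP => /(cut_link f); rewrite alT beF.
    * by apply/negP => /(cut_link f); rewrite alT beF.
Qed.

Lemma niso_sum : niso (sum_net A B) N =
  \sum_(f : cut N) niso A (part (side f) true) * niso B (part (side f) false).
Proof.
(* Each isomorphism is compatible with exactly one cut, so the inner sum is 1. *)
transitivity (\sum_(phi in isos (sum_net A B) N) \sum_(f : cut N | compat phi f) 1).
  rewrite /niso -sum1_card; apply: eq_bigr => phi /exists_compat[f hf].
  by rewrite (eq_bigl _ _ hf) big_pred1_eq.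
rewrite (exchange_big_dep xpredT) //=; apply: eq_bigr => f _.
rewrite /niso -cardsX -(card_imset _ (@glue_inj f)) -compat_isos -sum1_card.
by apply: eq_bigl => phi; rewrite !inE.
Qed.

End SumAdjoint.

(** * Cuts of a disjoint union *)

Section CutSum.
Variables A B : net.

Lemma cut_sum_spec (fg : cut A * cut B) : cut_spec (N := sum_net A B)
  [ffun x => match x with inl a => side fg.1 a | inr b => side fg.2 b end].
Proof.
apply/asboolP => -[a|b] k [a'|b'] l //=; rewrite !ffunE; exact: cut_link.
Qed.

Definition cut_sum (fg : cut A * cut B) : cut (sum_net A B) := Sub _ (cut_sum_spec fg).

Lemma cut_sum_bij : bijective cut_sum.
Proof.
apply: inj_surj_bij => [[f g] [f' g']|h].
  move=> /(congr1 val) /ffunP e; congr (_, _); apply: side_inj => x.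
    by have := e (inl x); rewrite !ffunE.
  by have := e (inr x); rewrite !ffunE.
have [b k b' l|f ef] := @exists_cut A (side h \o inl).
  by move=> lk; exact: (@cut_link (sum_net A B) h (inl b) k (inl b') l).
have [b k b' l|g eg] := @exists_cut B (side h \o inr).
  by move=> lk; exact: (@cut_link (sum_net A B) h (inr b) k (inr b') l).
by exists (f, g); apply: side_inj => -[a|b]; rewrite /side SubK ffunE; [exact: ef|exact: eg].
Qed.

Lemma part_cut_sum (f : cut A) (g : cut B) c :
  isom (part (side (cut_sum (f, g))) c) (sum_net (part (side f) c) (part (side g) c)).
Proof.
apply: isom_trans (part_sum _ _) _; apply: isom_sum; apply: eq_part => b.
  by rewrite /= /side SubK ffunE.
by rewrite /= /side SubK ffunE.
Qed.

End CutSum.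

(** The links form the graph of a bijection from output strings to input strings: range, totality,
    surjectivity, functionality, injectivity. This characterises the nets that come from closed
    diagrams. *)
Definition wired (p q : 'I_r -> nat) (N : net) : Prop :=
  [/\ forall b k b' l, @nlink N b k b' l -> k < p (nlab b) /\ l < q (nlab b'),
      forall (b : nbox N) k, k < p (nlab b) -> exists b' l, nlink b k b' l,
      forall (b' : nbox N) l, l < q (nlab b') -> exists b k, nlink b k b' l,
      forall (b : nbox N) k b1 l1 b2 l2,
        nlink b k b1 l1 -> nlink b k b2 l2 -> b1 = b2 /\ l1 = l2
    & forall (b' : nbox N) l b1 k1 b2 k2,
        nlink b1 k1 b' l -> nlink b2 k2 b' l -> b1 = b2 /\ k1 = k2].

(** A link joins boxes of the same colour, so the partner of a string of the part lies in the
    part. *)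
Lemma wired_part p q (N : net) (f : cut N) c : wired p q N -> wired p q (part (side f) c).
Proof.
move=> [w1 w2 w3 w4 w5]; split=> /=.
- by move=> b k b' l /w1.
- move=> b k /w2[b' [l lk]].
  have h : side f b' == c by rewrite -(cut_link f lk) (valP b).
  by exists (exist _ b' h), l.
- move=> b' l /w3[b [k lk]].
  have h : side f b == c by rewrite (cut_link f lk) (valP b').
  by exists (exist _ b h), k.
- move=> b k b1 l1 b2 l2 h1 h2.
  by have [e ->] := w4 _ _ _ _ _ _ h1 h2; split=> //; apply: val_inj.
- move=> b k b1 l1 b2 l2 h1 h2.
  by have [e ->] := w5 _ _ _ _ _ _ h1 h2; split=> //; apply: val_inj.
Qed.

End Nets.

(** * Closed diagrams as nets *)

Section DiagramNets.
Local Open Scope nat_scope.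
Variables (r : nat) (p q : 'I_r -> nat).
Implicit Types d : prediagram p q.

Definition net_of d : net r :=
  @Net r 'I_(size (boxes d)) (@label r p q d) (fun b k b' l => linked d b k b' l).

(** [net_iso] was shaped so that on [net_of] it unfolds to [diagram_iso]. *)
Lemma diagram_eqvE d d' : diagram_eqv d d' <-> isom (net_of d) (net_of d').
Proof. by split=> [/asboolP|h]; [|apply/asboolP]. Qed.

Lemma pi_eqE d d' :
  \pi_(diagram p q) d = \pi_(diagram p q) d' <-> isom (net_of d) (net_of d').
Proof. by rewrite -diagram_eqvE; split=> [/eqmodP|/eqmodP]. Qed.

Lemma isom_repr_pi d : isom (net_of (repr (\pi_(diagram p q) d))) (net_of d).
Proof. by apply/pi_eqE; rewrite reprK. Qed.

Lemma nth_map_label (u : 'I_r -> nat) d (b : 'I_(size (boxes d))) :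
  nth 0 (map u (boxes d)) b = u (label b).
Proof.
transitivity (u (nth (label b) (boxes d) b)); first exact: nth_map.
by rewrite [in RHS]/label (tnth_nth (label b)).
Qed.

Lemma flatten_index_inj (sh : seq nat) i j i' j' :
  j < nth 0 sh i -> j' < nth 0 sh i' ->
  flatten_index sh i j = flatten_index sh i' j' -> i = i' /\ j = j'.
Proof.
move=> h h' e; split.
- by rewrite -(flatten_indexKl h) e flatten_indexKl.
- by rewrite -(flatten_indexKr h) e flatten_indexKr.
Qed.

Lemma linked_bound d b k b' l : linked d b k b' l ->
  k < nth 0 (map p (boxes d)) b /\ l < nth 0 (map q (boxes d)) b'.
Proof. by case/and3P. Qed.

Lemma conn_uniq d : uniq (conn d).
Proof.
have /andP[_ h] := valP d.
by rewrite /conn (perm_uniq h) iota_uniq.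
Qed.

Lemma wired_net_of d : wired p q (net_of d).
Proof.
have /andP[/eqP sz pe] := valP d.
have pm v : (v \in conn d) = (v < sumn (map q (boxes d))).
  by rewrite /conn (perm_mem pe) mem_iota.
split=> /=.
- by move=> b k b' l /linked_bound; rewrite !nth_map_label.
- move=> b k; rewrite -nth_map_label => hk.
  have hc := flatten_indexP hk.
  have hv : nth 0 (conn d) (flatten_index (map p (boxes d)) b k) < sumn (map q (boxes d)).
    by apply: conn_lt; rewrite size_conn.
  have hb := reshape_indexP hv; rewrite size_map in hb.
  exists (Ordinal hb), (reshape_offset (map q (boxes d))
     (nth 0 (conn d) (flatten_index (map p (boxes d)) b k))).
  by rewrite /linked hk /= reshape_offsetP //= reshape_indexK.
- move=> b' l; rewrite -nth_map_label => hl.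
  have := flatten_indexP hl; rewrite -pm => hv.
  have hj : index (flatten_index (map q (boxes d)) b' l) (conn d) < sumn (map p (boxes d)).
    by rewrite -size_conn index_mem.
  have hb := reshape_indexP hj; rewrite size_map in hb.
  exists (Ordinal hb), (reshape_offset (map p (boxes d))
     (index (flatten_index (map q (boxes d)) b' l) (conn d))).
  by rewrite /linked hl /= reshape_offsetP //= reshape_indexK nth_index.
- move=> b k b1 l1 b2 l2 /and3P[_ h1 /eqP e1] /and3P[_ h2 /eqP e2].
  by have [/val_inj -> ->] := flatten_index_inj h1 h2 (etrans (esym e1) e2).
- move=> b' l b1 k1 b2 k2 /and3P[h1 _ /eqP e1] /and3P[h2 _ /eqP].
  rewrite -e1 => /eqP; rewrite nth_uniq ?conn_uniq ?size_conn ?flatten_indexP //.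
  by move=> /eqP e2; have [/val_inj -> ->] := flatten_index_inj h2 h1 e2.
Qed.

Lemma net_of_juxt d d' : isom (net_of (juxt d d')) (sum_net (net_of d) (net_of d')).
Proof.
apply: isom_sym.
have sz : size (boxes d) + size (boxes d') = size (boxes (juxt d d')) by rewrite size_cat.
exists (fun x : nbox (sum_net (net_of d) (net_of d')) => cast_ord sz (unsplit x)).
have bij : bijective (@unsplit (size (boxes d)) (size (boxes d'))).
  by exists (@split _ _); [exact: unsplitK|exact: splitK].
split.
- by apply: bij_comp bij; exists (cast_ord (esym sz)); [exact: cast_ordK|exact: cast_ordKV].
- case=> b /=; rewrite /label !(tnth_nth (label b)) /boxes /= nth_cat.
  + by rewrite ltn_ord.
  + by rewrite ltnNge leq_addr /= addKn.
- case=> b k [b'|b'] l /=.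
  + by rewrite linked_juxtll.
  + by rewrite linked_juxtlr.
  + by rewrite linked_juxtrl.
  + by rewrite linked_juxtrr.
Qed.

(** * Rebuilding a closed diagram from a wired net *)

Section Realize.
Variables (N : net r) (e : seq (nbox N)).
Hypotheses (e_uniq : uniq e) (e_full : forall b, b \in e).

Definition string_pos (u : 'I_r -> nat) (b : nbox N) (k : nat) : nat :=
  flatten_index (map u (map (@nlab r N) e)) (index b e) k.

Lemma nth_nlab (u : 'I_r -> nat) b :
  nth 0 (map u (map (@nlab r N) e)) (index b e) = u (nlab b).
Proof.
by rewrite -map_comp (nth_map b) ?index_mem //= nth_index.
Qed.

Lemma string_pos_lt u b k : k < u (nlab b) ->
  string_pos u b k < sumn (map u (map (@nlab r N) e)).
Proof. by move=> h; rewrite flatten_indexP // nth_nlab. Qed.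

Lemma string_pos_ex u j : j < sumn (map u (map (@nlab r N) e)) ->
  exists b k, k < u (nlab b) /\ j = string_pos u b k.
Proof.
move=> hj; have hi := reshape_indexP hj; have ho := reshape_offsetP hj.
rewrite !size_map in hi; have [x0 _] : exists x : nbox N, true.
  by move: hi; case: (e) => // x; exists x.
set i := reshape_index _ _ in hi ho; have ei : i = index (nth x0 e i) e by rewrite index_uniq.
exists (nth x0 e i), (reshape_offset (map u (map (@nlab r N) e)) j); split.
  by rewrite -nth_nlab -ei.
by rewrite /string_pos -ei reshape_indexK.
Qed.

Lemma string_pos_inj u b k b' k' : k < u (nlab b) -> k' < u (nlab b') ->
  string_pos u b k = string_pos u b' k' -> b = b' /\ k = k'.
Proof.
rewrite -(nth_nlab u b) -(nth_nlab u b') => h h' /(flatten_index_inj h h') [ei ->]; split=> //.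
by rewrite -[b](nth_index b (e_full b)) ei nth_index.
Qed.

(** The order [e] of the boxes is a parameter because basic invariants need boxes grouped by label,
    while elsewhere any enumeration will do. *)
Lemma realize : wired p q N ->
  exists d, boxes d = map (@nlab r N) e /\ isom (net_of d) N.
Proof.
move=> [w1 w2 w3 w4 w5].
(* [g] sends the number of an output string to the number of its input string; beyond the last
   output its value is arbitrary. *)
have /boolp.choice[g gP] j : exists v, j < sumn (map p (map (@nlab r N) e)) ->
    exists b k b' l, [/\ nlink b k b' l, j = string_pos p b k & v = string_pos q b' l].
  have [hj|hj] := ltnP j (sumn (map p (map (@nlab r N) e))); last by exists 0.
  have [b [k [hk ej]]] := string_pos_ex hj; have [b' [l lk]] := w2 _ _ hk.
  by exists (string_pos q b' l) => _; exists b, k, b', l.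
have gE b k b' l : nlink b k b' l -> g (string_pos p b k) = string_pos q b' l.
  move=> lk; have [hk _] := w1 _ _ _ _ lk.
  have [b1 [k1 [b1' [l1 [lk1 e1 ->]]]]] := gP _ (string_pos_lt hk).
  have [hk1 _] := w1 _ _ _ _ lk1.
  have [eb ek] := string_pos_inj hk hk1 e1; rewrite -eb -ek in lk1.
  by have [-> ->] := w4 _ _ _ _ _ _ lk lk1.
pose s := map (@nlab r N) e.
(* The list of values of [g] is a permutation: it has no repetition since links are injective, and
   it is exhaustive since every input is linked. *)
have spec : prediagram_spec p q (s, mkseq g (sumn (map p s))).
  rewrite /prediagram_spec /= size_mkseq eqxx /=; apply: uniq_perm.
  - rewrite map_inj_in_uniq ?iota_uniq // => j j'; rewrite !mem_iota /= !add0n => hj hj'.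
    have [b [k [b' [l [lk -> ->]]]]] := gP _ hj.
    have [c [m [c' [o [lk' -> ->]]]]] := gP _ hj'.
    have [_ hl] := w1 _ _ _ _ lk; have [_ ho] := w1 _ _ _ _ lk'.
    move=> /(string_pos_inj hl ho) [ec eo]; rewrite -ec -eo in lk'.
    by have [-> ->] := w5 _ _ _ _ _ _ lk lk'.
  - exact: iota_uniq.
  - move=> v; rewrite mem_iota /= add0n; apply/mapP/idP => [[j]|hv].
      rewrite mem_iota /= add0n => /gP[b [k [b' [l [lk _ ->]]]]] ->.
      by apply: string_pos_lt; case: (w1 _ _ _ _ lk).
    have [b' [l [hl ->]]] := string_pos_ex hv; have [b [k lk]] := w3 _ _ hl.
    exists (string_pos p b k); last by rewrite (gE _ _ _ _ lk).
    by rewrite mem_iota /= add0n string_pos_lt //; case: (w1 _ _ _ _ lk).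
exists (Sub _ spec); split; first by [].
apply: isom_sym; pose d : prediagram p q := Sub _ spec.
have hi (b : nbox N) : index b e < size (boxes d) by rewrite /boxes /= size_map index_mem.
exists (fun b => (Ordinal (hi b) : nbox (net_of d))); split.
- apply: inj_surj_bij => [b b' /(congr1 val) /= ei|i].
    by rewrite -[b](nth_index b (e_full b)) ei nth_index.
  have hie : i < size e by rewrite -(size_map (@nlab r N)); exact: (ltn_ord i).
  have [x0 _] : exists x : nbox N, true.
    by move: hie; case: (e) => // x; exists x.
  by exists (nth x0 e i); apply: val_inj; rewrite /= index_uniq.
- move=> b /=; rewrite /label (tnth_nth (nlab b)) /= /boxes /=.
  by rewrite (nth_map b) ?index_mem // nth_index.
- move=> b k b' l /=; rewrite /linked /boxes /= !nth_nlab /conn /=.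
  apply/and3P/idP => [[hk hl]|lk].
    rewrite nth_mkseq ?string_pos_lt //.
    have [b2 [l2 lk]] := w2 _ _ hk; have [_ hl2] := w1 _ _ _ _ lk.
    by rewrite -/(string_pos p b k) (gE _ _ _ _ lk) => /eqP/(string_pos_inj hl2 hl)[<- <-].
  have [hk hl] := w1 _ _ _ _ lk; split=> //.
  by rewrite nth_mkseq ?string_pos_lt // -/(string_pos p b k) (gE _ _ _ _ lk).
Qed.

End Realize.

Lemma exists_diagram (N : net r) : wired p q N ->
  exists D : diagram p q, isom (net_of (repr D)) N.
Proof.
move=> w; have [|b|d [_ h]] := @realize N (enum (nbox N)) _ _ w.
- exact: enum_uniq.
- by rewrite mem_enum.
by exists (\pi_(diagram p q) d); apply: isom_trans (isom_repr_pi d) h.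
Qed.

(* Junk value: the empty diagram when the net is not wired. *)
Definition diagram_of (N : net r) : diagram p q :=
  if pselect (wired p q N) is left w then sval (cid (exists_diagram w)) else dunit p q.

Lemma diagram_ofP (N : net r) : wired p q N -> isom (net_of (repr (diagram_of N))) N.
Proof. by move=> w; rewrite /diagram_of; case: pselect => // w'; case: cid. Qed.

Lemma isom_repr (D D' : diagram p q) :
  isom (net_of (repr D)) (net_of (repr D')) <-> D = D'.
Proof. by split=> [/pi_eqE|->]; [rewrite !reprK|apply: isom_refl]. Qed.

Lemma isom_dmul (D D' : diagram p q) :
  isom (net_of (repr (dmul D D'))) (sum_net (net_of (repr D)) (net_of (repr D'))).
Proof. by apply: isom_trans (isom_repr_pi _) _; apply: net_of_juxt. Qed.

End DiagramNets.

(** * Basic invariants *)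

Section Basic.
Local Open Scope nat_scope.
Variables (r : nat) (p q : 'I_r -> nat).
Implicit Types d : prediagram p q.
Notation deg := {ffun 'I_r -> nat}.

Definition net_degree (N : net r) : deg := [ffun i => #|[set b : nbox N | nlab b == i]|].

Lemma net_degree_isom N N' : isom N N' -> net_degree N = net_degree N'.
Proof.
have le (A B : net r) i : isom A B -> net_degree A i <= net_degree B i.
  move=> [f [/bij_inj fI lf _]]; rewrite !ffunE -(card_imset _ fI).
  apply/subset_leq_card/subsetP => _ /imsetP[b + ->].
  by rewrite !inE lf.
move=> h; apply/ffunP => i; apply/eqP.
by rewrite eqn_leq !le //; apply: isom_sym.
Qed.

Lemma net_degree_of d i : net_degree (net_of d) i = count_mem i (boxes d).
Proof.
rewrite ffunE -sum1_count big_tnth -sum1_card.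
by apply: eq_bigl => b; rewrite inE.
Qed.

Definition diagram_degree (D : diagram p q) : deg := net_degree (net_of (repr D)).

Lemma diagram_degree_pi d : diagram_degree (\pi_(diagram p q) d) = net_degree (net_of d).
Proof. exact/net_degree_isom/isom_repr_pi. Qed.

Lemma diagram_degreeM (D D' : diagram p q) :
  diagram_degree (dmul D D') = (diagram_degree D + diagram_degree D')%R.
Proof.
apply/ffunP => i; rewrite diagram_degree_pi [in RHS]ffunE /diagram_degree !net_degree_of.
by rewrite /boxes /= count_cat.
Qed.

Lemma diagram_degree0 (D : diagram p q) : diagram_degree D = 0%R -> D = dunit p q.
Proof.
move=> h; have b0 : boxes (repr D) = [::].
  case e : (boxes (repr D)) => [//|i s]; have := net_degree_of (repr D) i.
  by rewrite e /= eqxx -/(diagram_degree D) h ffunE.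
rewrite -[D]reprK; congr (\pi_(diagram p q) _); apply: val_inj => /=.
have := size_conn (repr D); rewrite b0 => /= /size0nil.
by move: b0; rewrite /boxes /conn /=; case: (sval (repr D)) => s c /= -> ->.
Qed.

Lemma diagram_degree1 : diagram_degree (dunit p q) = 0%R.
Proof. by apply/ffunP => i; rewrite diagram_degree_pi net_degree_of ffunE. Qed.

Section Standard.
Variable n_ : deg.
Local Notation box := (Tagged (fun i : 'I_r => 'I_(n_ i))).

Lemma count_standard_boxes i : count_mem i (standard_boxes n_) = n_ i.
Proof.
rewrite /standard_boxes count_flatten -map_comp sumnE big_map big_enum /=.
rewrite (bigD1 i) //= count_nseq /= eqxx mul1n big1 ?addn0 // => j /negbTE h.
by rewrite count_nseq /= h.
Qed.

(** Isolates the run of boxes labelled [i], so that positions inside it can be computed by the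
    lemmas on concatenation. *)
Lemma standard_boxes_split (i : 'I_r) : exists t : seq 'I_r,
  standard_boxes n_ =
  flatten [seq nseq (n_ j) j | j <- take i (enum 'I_r)] ++ nseq (n_ i) i ++ t.
Proof.
exists (flatten [seq nseq (n_ j) j | j <- drop i.+1 (enum 'I_r)]).
rewrite /standard_boxes -{1}(cat_take_drop i (enum 'I_r)) map_cat flatten_cat.
by rewrite (drop_nth i) ?size_enum_ord //= nth_ord_enum.
Qed.

Definition box_pos (x : {i : 'I_r & 'I_(n_ i)}) : nat :=
  flatten_index [seq n_ i | i <- enum 'I_r] (tag x) (tagged x).

Lemma nth_enum_map (u : 'I_r -> nat) (i : 'I_r) : nth 0 [seq u j | j <- enum 'I_r] i = u i.
Proof. by rewrite (nth_map i) ?size_enum_ord // nth_ord_enum. Qed.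

Lemma size_standard_boxes : size (standard_boxes n_) = sumn [seq n_ i | i <- enum 'I_r].
Proof.
rewrite size_flatten /shape -map_comp; congr sumn.
by apply: eq_map => i /=; rewrite size_nseq.
Qed.

Lemma box_pos_lt x : box_pos x < size (standard_boxes n_).
Proof. by rewrite size_standard_boxes flatten_indexP // nth_enum_map. Qed.

Lemma box_pos_inj : injective box_pos.
Proof.
move=> [i a] [j b] /flatten_index_inj /=; rewrite !nth_enum_map.
move=> /(_ (ltn_ord _) (ltn_ord _)).
by case=> /val_inj e; case: j / e b => b /val_inj ->.
Qed.

Lemma box_pos_ex b : b < size (standard_boxes n_) -> exists x, box_pos x = b.
Proof.
rewrite size_standard_boxes => hb; have := reshape_indexP hb.
rewrite size_map size_enum_ord => hi.
have := reshape_offsetP hb; rewrite -[reshape_index _ _]/(val (Ordinal hi)) nth_enum_map => ho.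
by exists (box (Ordinal ho)); rewrite /box_pos /= reshape_indexK.
Qed.

Lemma size_take_standard (u : 'I_r -> nat) (i : 'I_r) :
  sumn (map u (flatten [seq nseq (n_ j) j | j <- take i (enum 'I_r)])) =
  sumn (take i [seq n_ j * u j | j <- enum 'I_r]).
Proof.
rewrite -map_take; elim: (take i _) => //= j s IHs.
by rewrite map_cat sumn_cat IHs map_nseq sumn_nseq mulnC.
Qed.

Lemma standard_split_pos (i : 'I_r) :
  size (flatten [seq nseq (n_ j) j | j <- take i (enum 'I_r)]) =
  sumn (take i [seq n_ j | j <- enum 'I_r]).
Proof.
by rewrite -map_take; elim: (take i _) => //= j s IHs; rewrite size_cat IHs size_nseq.
Qed.

Lemma nth_standard_boxes x0 x : nth x0 (standard_boxes n_) (box_pos x) = tag x.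
Proof.
case: x => i a; have [t ->] := standard_boxes_split i.
rewrite nth_cat /box_pos /flatten_index /= standard_split_pos ltnNge leq_addr /= addKn.
by rewrite nth_cat size_nseq ltn_ord nth_nseq ltn_ord.
Qed.

(** Reconciles two numberings of strings: box by box, as in diagrams, and by blocks inside the
    interval of a label, as in [block_perm]. *)
Lemma flatten_index_standard (u : 'I_r -> nat) x k :
  flatten_index (map u (standard_boxes n_)) (box_pos x) k = block_pos u (tagged x) k.
Proof.
case: x => i a; have [t ->] := standard_boxes_split i.
rewrite /block_pos /box_pos /flatten_index /= -map_take take_cat standard_split_pos.
rewrite ltnNge leq_addr /= addKn take_cat size_nseq ltn_ord.
rewrite map_cat sumn_cat size_take_standard take_nseq ?(ltnW (ltn_ord a)) //.
by rewrite map_nseq sumn_nseq mulnC addnA.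
Qed.

Lemma block_pos_inj (u : 'I_r -> nat) (x y : {i : 'I_r & 'I_(n_ i)}) k l :
  k < u (tag x) -> l < u (tag y) ->
  block_pos u (tagged x) k = block_pos u (tagged y) l -> x = y /\ k = l.
Proof.
have nthE z : nth 0 (map u (standard_boxes n_)) (box_pos z) = u (tag z).
  by rewrite (nth_map (tag z)) ?box_pos_lt // nth_standard_boxes.
rewrite -!flatten_index_standard -(nthE x) -(nthE y) => hk hl.
by move=> /(flatten_index_inj hk hl)[/box_pos_inj -> ->].
Qed.

(** * Symmetries of basic invariants *)

Section BasicNet.
Variable n : nat.
Hypotheses (hp : \sum_(i < r) n_ i * p i = n) (hq : \sum_(i < r) n_ i * q i = n).

(** The basic invariant of [sigma] with each box named by its label and its rank among the boxes of
    that label; on such names the product of symmetric groups acts without arithmetic. *)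
Definition std_net (sigma : 'S_n) : net r :=
  @Net r {i : 'I_r & 'I_(n_ i)} (fun x => tag x) (fun x k y l =>
    [&& k < p (tag x), l < q (tag y) &
      [exists j : 'I_n, (val j == block_pos p (tagged x) k) &&
         (val (sigma j) == block_pos q (tagged y) l)]]).

Lemma std_net_isom sigma : isom (std_net sigma) (net_of (basic_prediagram hp hq sigma)).
Proof.
exists (fun x : nbox (std_net sigma) =>
  (Ordinal (box_pos_lt x) : nbox (net_of (basic_prediagram hp hq sigma)))).
have nthE u z : nth 0 (map u (standard_boxes n_)) (box_pos z) = u (tag z).
  by rewrite (nth_map (tag z)) ?box_pos_lt // nth_standard_boxes.
split.
- apply: inj_surj_bij => [x y /(congr1 val) /= /box_pos_inj //|b].
  by have [x e] := box_pos_ex (ltn_ord b); exists x; apply: val_inj.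
- by move=> x /=; rewrite /label (tnth_nth (tag x)) /= nth_standard_boxes.
- move=> x k y l /=; rewrite /linked /= /boxes /= !nthE.
  have [hk /=|//] := boolP (k < p (tag x)); congr andb.
  rewrite !flatten_index_standard /conn /=.
  have hj := block_pos_lt hp (tagged x) hk.
  rewrite (nth_map (Ordinal hj)) ?size_enum_ord //.
  rewrite -[block_pos p _ _ in LHS]/(val (Ordinal hj)) nth_ord_enum.
  apply/idP/existsP => [h|[j /andP[/eqP ej]]];
    last by have -> : j = Ordinal hj by apply: val_inj.
  by exists (Ordinal hj); rewrite /= eqxx.
Qed.

Lemma std_link_bound sigma x k y l : @nlink r (std_net sigma) x k y l ->
  k < p (tag x) /\ l < q (tag y).
Proof. by case/and3P. Qed.

Lemma std_linkP sigma x k y l :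
  k < p (tag x) -> l < q (tag y) -> forall j : 'I_n, val j = block_pos p (tagged x) k ->
  @nlink r (std_net sigma) x k y l = (val (sigma j) == block_pos q (tagged y) l).
Proof.
move=> hk hl j ej; rewrite /= hk hl /=.
apply/existsP/idP => [[i /andP[/eqP ei]]|h]; last by exists j; rewrite ej eqxx.
by have -> : i = j by apply: val_inj; rewrite [LHS]ei ej.
Qed.

Notation G := {dffun forall i : 'I_r, 'S_(n_ i)}.

Definition box_map (g : G) : {ffun {i : 'I_r & 'I_(n_ i)} -> {i : 'I_r & 'I_(n_ i)}} :=
  [ffun x => box (g (tag x) (tagged x))].

Lemma box_map_inj : injective box_map.
Proof.
move=> g h /ffunP e; apply/ffunP => i; apply/permP => a.
have := e (box a); rewrite !ffunE /= => /eqP.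
by rewrite eq_Tagged => /eqP.
Qed.

Lemma box_map_bij g : bijective (box_map g).
Proof.
have K (h h' : G) : (forall i, cancel (h i) (h' i)) -> cancel (box_map h) (box_map h').
  by move=> hh [i a]; rewrite !ffunE /= hh.
exists (box_map [ffun i => (g i)^-1%g]); apply: K => i a; rewrite ffunE;
  [exact: permK|exact: permKV].
Qed.

Lemma block_perm_pos (u : 'I_r -> nat) (hu : \sum_(i < r) n_ i * u i = n) (g : G)
    (x : {i : 'I_r & 'I_(n_ i)}) k (j : 'I_n) : k < u (tag x) ->
  val j = block_pos u (tagged x) k ->
  val (block_perm hu g j) = block_pos u (tagged (box_map g x)) k.
Proof. by move=> hk ej; rewrite permE /= ej block_funE // ffunE. Qed.

(** The block permutation of [g^-1] is moved to the other side. The resulting intertwining relation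
    is what preservation of links says string by string. *)
Lemma transporterP (sigma tau : 'S_n) (g : G) :
  reflect (forall j, block_perm hq g (sigma j) = tau (block_perm hp g j))
    (g \in KX_transporter hp hq sigma tau).
Proof.
have gK : cancel (block_perm hp g) (block_perm hp g^-1%g).
  move=> j; apply: val_inj; rewrite !permE /=.
  have [i [a [k [hk ->]]]] := block_posP hp (ltn_ord j).
  by rewrite !block_funE // ffunE permK.
apply: (iffP forallP) => /= [h j|h j].
  by rewrite -(eqP (h (block_perm hp g j))) gK.
have [i <-] : exists i, block_perm hp g i = j.
  by exists ((block_perm hp g)^-1%g j); rewrite permKV.
by rewrite gK h.
Qed.

(** A label-preserving bijection of the boxes is a family of permutations, one for each label; it
    preserves links exactly when the induced permutations of strings intertwine [sigma] and
    [tau]. *)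
Lemma transporter_isos (sigma tau : 'S_n) :
  [set box_map g | g in KX_transporter hp hq sigma tau] = isos (std_net sigma) (std_net tau).
Proof.
have posP u (hu : \sum_(i < r) n_ i * u i = n) (j : 'I_n) :
    exists (x : {i : 'I_r & 'I_(n_ i)}) k, k < u (tag x) /\ val j = block_pos u (tagged x) k.
  have [i [a [k [hk e]]]] := block_posP hu (ltn_ord j).
  by exists (box a), k.
apply/setP => f; apply/imsetP/idP => [[g /transporterP gP ->]|].
- rewrite inE; apply/asboolP; split.
  + exact: box_map_bij.
  + by move=> x; rewrite ffunE.
  + move=> x k y l.
    have tg z : tag (box_map g z) = tag z by rewrite ffunE.
    have [hk|hk] := boolP (k < p (tag x)); last first.
      by apply/idP/idP => /std_link_bound[]; rewrite ?tg (negbTE hk).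
    have [hl|hl] := boolP (l < q (tag y)); last first.
      by apply/idP/idP => /std_link_bound[_]; rewrite ?tg (negbTE hl).
    pose j : 'I_n := Ordinal (block_pos_lt hp (tagged x) hk).
    rewrite (@std_linkP _ _ _ _ _ hk hl j) //.
    rewrite (@std_linkP _ _ _ _ _ _ _ (block_perm hp g j)) ?tg //; last exact: block_perm_pos.
    rewrite -gP; have [z [m [hm ez]]] := posP q hq (sigma j).
    rewrite (block_perm_pos _ _ hm ez) ez; apply/eqP/eqP.
      move=> e; have [|//|/(bij_inj (box_map_bij g)) -> -> //] := block_pos_inj _ _ e;
        by rewrite tg.
    by move=> e; have [-> ->] := block_pos_inj hm hl e.
- rewrite inE => /asboolP[bij lab lnk].
  (* As [f] preserves labels, it restricts to each label class; [tagged_as] transports the rank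
     along the equality of labels. *)
  have [g ef] : exists g, f = box_map g.
    have tagE (i : 'I_r) (a : 'I_(n_ i)) : tag (f (box a)) = i.
      exact: (lab (box a)).
    pose h i (a : 'I_(n_ i)) : 'I_(n_ i) :=
      tagged_as (box a) (f (box a)).
    have hE i (a : 'I_(n_ i)) : box (h i a) = f (box a).
      rewrite /h; have := tagE i a; case: (f _) => j b /= e.
      by case: i / e a => a; rewrite tagged_asE.
    have hI i : injective (h i).
      move=> a b e; have : f (box a) = f (box b).
        by rewrite -!hE e.
      by move=> /(bij_inj bij) /eqP; rewrite eq_Tagged => /eqP.
    exists [ffun i => perm (hI i)]; apply/ffunP => -[i a].
    by rewrite !ffunE /= permE -hE.
  exists g => //; apply/transporterP => j; rewrite ef in lnk.
  have [x [k [hk ej]]] := posP p hp j; have [y [l [hl el]]] := posP q hq (sigma j).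
  have tg z : tag (box_map g z) = tag z by rewrite ffunE.
  have := lnk x k y l.
  rewrite (@std_linkP sigma _ _ _ _ hk hl j ej) el eqxx.
  have ej' := block_perm_pos hp g hk ej.
  rewrite (@std_linkP tau _ _ _ _ _ _ _ ej') ?tg // => /eqP et.
  by apply: val_inj; rewrite et; apply: block_perm_pos.
Qed.

Lemma card_transporter (sigma tau : 'S_n) :
  #|KX_transporter hp hq sigma tau| =
  niso (net_of (basic_prediagram hp hq sigma)) (net_of (basic_prediagram hp hq tau)).
Proof.
rewrite -(niso_isom (std_net_isom sigma) (std_net_isom tau)).
by rewrite /niso -transporter_isos card_imset //; apply: box_map_inj.
Qed.

End BasicNet.

Lemma net_degree_basic n (hp : \sum_(i < r) n_ i * p i = n) (hq : \sum_(i < r) n_ i * q i = n)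
  (sigma : 'S_n) : net_degree (net_of (basic_prediagram hp hq sigma)) = n_.
Proof. by apply/ffunP => i; rewrite net_degree_of count_standard_boxes. Qed.

(** The boxes are reordered by label. Realizing the net in this order gives the standard list of
    boxes, and the connection is then a permutation. *)
Lemma exists_basic d : net_degree (net_of d) = n_ ->
  exists n hp hq (sigma : 'S_n),
    isom (net_of d) (net_of (@basic_prediagram r p q n_ n hp hq sigma)).
Proof.
move=> dn.
pose row (i : 'I_r) := [seq b <- enum (nbox (net_of d)) | nlab b == i].
pose e := flatten [seq row i | i <- enum 'I_r].
have size_row i : size (row i) = n_ i.
  rewrite -dn ffunE /row size_filter -sum1_count big_enum_cond -sum1_card.
  by apply: eq_bigl => b; rewrite !inE.
have lab_e : map (@nlab r (net_of d)) e = standard_boxes n_.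
  rewrite /e /standard_boxes map_flatten -map_comp; congr flatten.
  apply: eq_map => i /=; rewrite -size_row.
  have : all (fun b => nlab b == i) (row i) by apply: filter_all.
  by elim: (row i) => //= b s IHs /andP[/eqP -> /IHs ->].
have e_full b : b \in e.
  apply/flattenP; exists (row (nlab b)); first by apply: map_f; rewrite mem_enum.
  by rewrite mem_filter eqxx mem_enum.
have e_uniq : uniq e.
  (* A list that contains every box and is no longer than their enumeration has no repetition. *)
  apply: (leq_size_uniq (enum_uniq (nbox (net_of d)))) => [b _|]; first exact: e_full.
  rewrite size_flatten /shape -map_comp sumnE big_map big_enum -cardE -sum1_card.
  rewrite (partition_big (@nlab r (net_of d)) xpredT) //=; apply: leq_sum => i _.
  by rewrite size_row -dn ffunE -sum1_card; apply/eq_leq/eq_bigl => b; rewrite inE.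
have [d' [bd' iso]] := realize e_uniq e_full (wired_net_of d).
rewrite lab_e in bd'.
pose n := \sum_(i < r) n_ i * p i.
have sz : size (conn d') = n by rewrite size_conn bd' sumn_standard_boxes.
(* The connection matches outputs with inputs, so there are equally many. *)
have hq : \sum_(i < r) n_ i * q i = n.
  have /andP[_ /perm_size] := valP d'; rewrite -/(conn d') -/(boxes d') sz size_iota bd'.
  by rewrite sumn_standard_boxes.
have lt (j : 'I_n) : nth 0 (conn d') j < n.
  by rewrite -[X in _ < X]hq -sumn_standard_boxes -bd' conn_lt // sz.
have inj : injective (fun j => Ordinal (lt j)).
  move=> i j /(congr1 val) /= /eqP; rewrite nth_uniq ?sz ?conn_uniq // => /eqP.
  exact: val_inj.
exists n, erefl, hq, (perm inj); apply: isom_trans (isom_sym iso) _.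
suff e' : d' = basic_prediagram erefl hq (perm inj) by rewrite -e'; exact: isom_refl.
apply: val_inj; rewrite /= -bd' [LHS]surjective_pairing; congr (_, _).
apply: (@eq_from_nth _ 0) => [|j]; first by rewrite size_map size_enum_ord.
rewrite -/(conn d') sz => hj.
by rewrite (nth_map (Ordinal hj)) ?size_enum_ord // permE /= nth_enum_ord.
Qed.
End Standard.
End Basic.

(** * Splittings of a closed diagram *)

Section Connected.
Local Open Scope nat_scope.
Variables (r : nat) (p q : 'I_r -> nat).
Local Notation diag := (diagram p q).
Implicit Types (d : prediagram p q) (D : diag).

Definition dnet D : net r := net_of (repr D).

Lemma wired_dnet D : wired p q (dnet D).
Proof. exact: wired_net_of. Qed.

Lemma isom_dnet D D' : isom (dnet D) (dnet D') <-> D = D'.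
Proof. exact: isom_repr. Qed.

Lemma diagram_of_eq (N : net r) D : wired p q N -> isom (dnet D) N -> diagram_of p q N = D.
Proof.
by move=> w h; apply/isom_dnet; apply: isom_trans (diagram_ofP w) (isom_sym h).
Qed.

Lemma dnet_empty D : (nbox (dnet D) -> False) -> D = dunit p q.
Proof.
move=> h; apply: diagram_degree0; apply/ffunP => i; rewrite !ffunE.
by apply/eqP; rewrite cards_eq0; apply/eqP/setP => b; case: (h b).
Qed.

Lemma dnet_nonempty D : D <> dunit p q -> exists b : nbox (dnet D), true.
Proof.
by move=> h; apply: contrapT => h'; apply/h/dnet_empty => b; apply: h'; exists b.
Qed.

Lemma dunit_empty : nbox (dnet (dunit p q)) -> False.
Proof.
have [f _] := isom_repr_pi (empty_prediagram p q).
by move=> /f [].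
Qed.

Definition aut D : nat := niso (dnet D) (dnet D).

Lemma aut_gt0 D : 0 < aut D.
Proof. exact/niso_gt0/isom_refl. Qed.

Lemma aut_dunit : aut (dunit p q) = 1.
Proof.
apply/eqP; rewrite eqn_leq aut_gt0 andbT.
apply: leq_trans (max_card _) _; rewrite card_ffun.
by rewrite (eq_card0 (A := nbox (dnet (dunit p q)))) ?expn0 // => b; case: (dunit_empty b).
Qed.

Lemma niso_dnet D D' : niso (dnet D) (dnet D') = (D == D') * aut D.
Proof.
case: eqP => [<-|h]; first by rewrite mul1n.
apply/eqP; rewrite mul0n -leqn0 leqNgt; apply/negP => /niso_gt0.
by move=> /isom_dnet.
Qed.

Lemma niso_wired D (N : net r) : wired p q N ->
  niso (dnet D) N = (D == diagram_of p q N) * aut D.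
Proof.
move=> w; rewrite -niso_dnet; apply: niso_isom (isom_refl _) _.
exact/isom_sym/diagram_ofP.
Qed.

Lemma niso_dmul D D' (N : net r) :
  niso (sum_net (dnet D) (dnet D')) N = niso (dnet (dmul D D')) N.
Proof. by apply: niso_isom (isom_refl _); apply/isom_sym/isom_dmul. Qed.

(** The isomorphism is obtained by counting: in [niso_sum] the term of [f] is positive, because of
    the identities of the two parts. *)
Lemma isom_parts (N : net r) (f : cut N) :
  isom (sum_net (part (side f) true) (part (side f) false)) N.
Proof.
apply/niso_gt0; rewrite niso_sum (bigD1 f) //= addn_gt0 muln_gt0.
by apply/orP; left; apply/andP; split; exact/niso_gt0/isom_refl.
Qed.

Lemma dmul_diagram_of (N N' : net r) : wired p q N -> wired p q N' ->
  isom (dnet (dmul (diagram_of p q N) (diagram_of p q N'))) (sum_net N N').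
Proof.
move=> w w'; apply: isom_trans (isom_dmul _ _) _.
by apply: isom_sum; apply: diagram_ofP.
Qed.

Lemma dmul_parts D (f : cut (dnet D)) :
  dmul (diagram_of p q (part (side f) true)) (diagram_of p q (part (side f) false)) = D.
Proof.
apply/isom_dnet; apply: isom_trans (isom_parts f).
by apply: dmul_diagram_of; apply: wired_part; apply: wired_dnet.
Qed.

Lemma connected_cut d (f : cut (net_of d)) b b' :
  connected_diagram d -> side f b = side f b'.
Proof.
move=> /andP[_ /forallP/(_ b)/forallP/(_ b')] h.
apply: (@closed_connect _ _ (side f) _ _ _ h) => x y /orP[] /existsP[k /existsP[l lk]].
- exact: (cut_link f lk).
- exact/esym/(cut_link f lk).
Qed.

(** If both factors had a box, the cut induced by the juxtaposition would separate two boxes of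
    [d]. *)
Lemma connected_dmul d D D' : connected_diagram d ->
  \pi_diag d = dmul D D' -> D = dunit p q \/ D' = dunit p q.
Proof.
move=> cd e; apply: contrapT => /not_orP[/dnet_nonempty[a _] /dnet_nonempty[b _]].
have [phi phi_iso] : isom (sum_net (dnet D) (dnet D')) (net_of d).
  apply: isom_trans (isom_sym (isom_dmul D D')) _; rewrite -e.
  exact: isom_repr_pi.
have [f hf] := exists_compat (net_iso_ffun phi_iso).
have cmp : compat (finfun phi) f by rewrite hf.
have /eqP ca := forallP cmp (inl a); have /eqP cb := forallP cmp (inr b).
have := @connected_cut d f (finfun phi (inl a)) (finfun phi (inr b)) cd.
by rewrite ca cb.
Qed.

Lemma connected_neq1 d : connected_diagram d -> \pi_diag d <> dunit p q.
Proof. by move=> /andP[+ _] /pi_eq_one e; rewrite e. Qed.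

Lemma disconnected_cut d : 0 < size (boxes d) -> ~~ connected_diagram d ->
  exists (f : cut (net_of d)) b b', side f b /\ ~~ side f b'.
Proof.
move=> s0; rewrite /connected_diagram s0 /= => /forallPn[b /forallPn[b' nb]].
set e := relU _ _ in nb.
have es : connect_sym e.
  by apply: sym_connect_sym => x y; rewrite /e /= orbC.
(* The cut is the connected component of [b], which misses [b']. *)
have [x k y l lk|f ef] := @exists_cut _ (net_of d) (connect e b).
  have [hk hl] := linked_bound lk; rewrite !nth_map_label in hk hl.
  apply: (same_connect1r es); apply/orP; left.
  by apply/existsP; exists (Ordinal hk); apply/existsP; exists (Ordinal hl).
by exists f, b, b'; rewrite !ef connect0.
Qed.

Lemma card_dnet_of (N : net r) : wired p q N -> #|nbox (dnet (diagram_of p q N))| = #|nbox N|.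
Proof. by move=> /diagram_ofP[f [bij _ _]]; apply: bij_eq_card bij. Qed.

(** Connected diagrams generate the monoid, by induction on the number of boxes: a disconnected
    diagram is the product of the two sides of a nontrivial cut. *)
Lemma diagram_ind (P : diag -> Prop) : P (dunit p q) ->
  (forall d, connected_diagram d -> P (\pi_diag d)) ->
  (forall D D', P D -> P D' -> P (dmul D D')) -> forall D, P D.
Proof.
move=> P1 Pc PM D; have [n] := ubnP #|nbox (dnet D)|; elim: n D => // n IHn D.
rewrite ltnS => le_n.
have [->|/dnet_nonempty[b0 _]] := pselect (D = dunit p q); first exact: P1.
have [cd|ncd] := boolP (connected_diagram (repr D)); first by rewrite -[D]reprK; apply: Pc.
have [|f [b [b' [fb fb']]]] := disconnected_cut _ ncd;
  first by apply: leq_ltn_trans (ltn_ord b0).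
rewrite -(dmul_parts f).
(* The true side misses [b'] and the false side misses [b]. *)
have lt c : #|nbox (part (side f) c)| < #|nbox (dnet D)|.
  rewrite card_sig; apply: (leq_trans (n := #|[set~ (if c then b' else b)]|.+1)).
    rewrite ltnS; apply/subset_leq_card/subsetP => x; rewrite !inE => /eqP fx.
    by apply/eqP => xe; move: fx fb fb'; rewrite xe; case: c xe => _ ->.
  by rewrite cardsC1 prednK //; apply/card_gt0P; exists b.
have w c := wired_part f c (wired_dnet D).
by apply: PM; apply: IHn; rewrite card_dnet_of //; apply: leq_trans (lt _) le_n.
Qed.

(** A list with one entry per cut, since the multiplicities are the coefficients of the
    coproduct. *)
Definition net_splits (N : net r) : seq (diag * diag) :=
  [seq (diagram_of p q (part (side f) true), diagram_of p q (part (side f) false))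
     | f <- enum {: cut N}].

Definition splits D := net_splits (dnet D).

(** [niso_sum] with each factor evaluated: a cut contributes the product of the automorphism orders
    when its sides are [D] and [D'], and 0 otherwise. *)
Lemma count_net_splits (N : net r) D D' : wired p q N ->
  count_mem (D, D') (net_splits N) * (aut D * aut D') = niso (dnet (dmul D D')) N.
Proof.
move=> w; rewrite -niso_dmul niso_sum count_map -sum1_count big_enum_cond big_distrl /=.
rewrite big_mkcond; apply: eq_bigr => f _.
rewrite !niso_wired; try exact: wired_part.
rewrite mulnACA mulnb mul1n -pair_eqE /= /pair_eq /= ![_ == diagram_of _ _ _]eq_sym.
by case: ifP => _; rewrite ?mul1n ?mul0n.
Qed.

Lemma perm_count_mem (T : eqType) (s t : seq T) :
  (forall x, count_mem x s = count_mem x t) -> perm_eq s t.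
Proof. by move=> h; apply/allP => x _; apply/eqP/h. Qed.

(** The multiplicities are determined by numbers of isomorphisms, which are invariant, after
    cancelling the positive automorphism orders. *)
Lemma net_splits_isom (N N' : net r) : wired p q N -> wired p q N' -> isom N N' ->
  perm_eq (net_splits N) (net_splits N').
Proof.
move=> w w' iso; apply: perm_count_mem => -[D D']; apply/eqP.
rewrite -(@eqn_pmul2r (aut D * aut D')) ?muln_gt0 ?aut_gt0 // !count_net_splits //.
by rewrite (niso_isom (isom_refl _) iso).
Qed.

Lemma wired_sum (N N' : net r) : wired p q N -> wired p q N' -> wired p q (sum_net N N').
Proof.
move=> [a1 a2 a3 a4 a5] [b1 b2 b3 b4 b5]; split.
- by move=> [b|b] k [b'|b'] l //= => [/a1|/b1].
- move=> [b|b] k /= => [/a2|/b2] [b' [l h]]; by [exists (inl b'), l|exists (inr b'), l].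
- move=> [b|b] k /= => [/a3|/b3] [b' [l h]]; by [exists (inl b'), l|exists (inr b'), l].
- move=> [b|b] k [c|c] l [d|d] m //= h h'.
    by have [-> ->] := a4 _ _ _ _ _ _ h h'.
  by have [-> ->] := b4 _ _ _ _ _ _ h h'.
- move=> [b|b] k [c|c] l [d|d] m //= h h'.
    by have [-> ->] := a5 _ _ _ _ _ _ h h'.
  by have [-> ->] := b5 _ _ _ _ _ _ h h'.
Qed.

Lemma perm_cut_sum (N N' : net r) : perm_eq (enum {: cut (sum_net N N')})
  [seq cut_sum (f, g) | f <- enum {: cut N}, g <- enum {: cut N'}].
Proof.
have [h hK Kh] := cut_sum_bij N N'.
apply: uniq_perm; first exact: enum_uniq.
  apply: allpairs_uniq; rewrite ?enum_uniq // => -[f g] [f' g'] _ _.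
  exact: (can_inj hK).
move=> f; rewrite mem_enum; apply/esym/allpairsP.
by exists (h f); rewrite !mem_enum; split=> //; rewrite -surjective_pairing Kh.
Qed.

(** Multiplicativity of the coproduct: a cut of a juxtaposition is a pair of cuts, and each of its
    sides is the juxtaposition of the corresponding sides. *)
Lemma splitsM D D' : perm_eq (splits (dmul D D'))
  [seq (dmul x.1 y.1, dmul x.2 y.2) | x <- splits D, y <- splits D'].
Proof.
have w := wired_dnet D; have w' := wired_dnet D'.
apply: perm_trans (net_splits_isom (wired_dnet _) (wired_sum w w') (isom_dmul D D')) _.
apply: perm_trans (perm_map _ (perm_cut_sum _ _)) _.
rewrite map_allpairs /splits /net_splits allpairs_mapl allpairs_mapr.
have dE (f : cut (dnet D)) (g : cut (dnet D')) c :
    diagram_of p q (part (side (cut_sum (f, g))) c) =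
    dmul (diagram_of p q (part (side f) c)) (diagram_of p q (part (side g) c)).
  apply: diagram_of_eq; first by apply: wired_part; apply: wired_sum.
  apply: isom_trans (dmul_diagram_of (wired_part f c w) (wired_part g c w')) _.
  exact/isom_sym/part_cut_sum.
(* The two lists are now equal entry by entry, so the permutation is the identity. *)
apply: (eq_ind _ (perm_eq _) (perm_refl _)); apply: eq_allpairs => f g.
by rewrite !dE.
Qed.

Lemma count_splits D D' E :
  count_mem (D, D') (splits E) * (aut D * aut D') = (dmul D D' == E) * aut (dmul D D').
Proof. by rewrite count_net_splits ?niso_dnet //; apply: wired_dnet. Qed.

End Connected.

(** * Linear algebra of tensors and free modules *)

Section LinearMaps.
Variables (K : fieldType) (U V : lmodType K).

Lemma linear_add (f : U -> V) : linear f -> {morph f : x y / x + y}.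
Proof. by move=> h x y; have := h 1 x y; rewrite !scale1r. Qed.

Lemma linear_zero (f : U -> V) : linear f -> f 0 = 0.
Proof. by move=> h; have := h (-1) 0 0; rewrite scaler0 addr0 scaleN1r addNr. Qed.

Lemma linear_scale (f : U -> V) : linear f -> forall a x, f (a *: x) = a *: f x.
Proof. by move=> h a x; have := h a x 0; rewrite (linear_zero h) !addr0. Qed.

Lemma linear_bigsum (f : U -> V) (hf : linear f) (I : Type) (s : seq I) (P : pred I)
    (F : I -> U) :
  f (\sum_(i <- s | P i) F i) = \sum_(i <- s | P i) f (F i).
Proof. by apply: big_morph; [exact: linear_add|exact: linear_zero]. Qed.

End LinearMaps.

Section TensorLift.
Variables (K : fieldType) (U V W : lmodType K).

(** A predicate on bare functions, because [tlift] takes any function but has the expected value on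
    pure tensors only when bilinearity is known. *)
Definition blinear (f : U -> V -> W) : Prop :=
  (forall v, linear (f^~ v)) /\ (forall u, linear (f u)).

Lemma tlift_blinear (f : U -> V -> W) : blinear f ->
  linear (tlift f) /\ forall u v, tlift f (u ⊗ v) = f u v.
Proof.
move=> [hl hr].
have bf : bilinear_for *:%R *:%R f by split=> [v a u u'|u a v v']; [exact: hl|exact: hr].
pose g := bilinear_isBilinear.Build K U V W *:%R *:%R f bf.
pose F : {bilinear U -> V -> W} := HB.pack f g.
split=> [|u v]; first exact: (tlift_is_linear F).
exact: (tlift_tens F).
Qed.

Lemma tlift_linear (f : U -> V -> W) : blinear f -> linear (tlift f).
Proof. by case/tlift_blinear. Qed.

Lemma tliftE (f : U -> V -> W) u v : blinear f -> tlift f (u ⊗ v) = f u v.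
Proof. by case/tlift_blinear. Qed.

Lemma eq_tlift (f g : U -> V -> W) t : f =2 g -> tlift f t = tlift g t.
Proof. by move=> h; apply: eq_bigr => x _; apply: h. Qed.

Lemma tensPl a (u u' : U) (v : V) : (a *: u + u') ⊗ v = a *: (u ⊗ v) + u' ⊗ v.
Proof. by have [h _] := tens_is_bilinear U V; exact: (h v a u u'). Qed.

Lemma tensPr a (u : U) (v v' : V) : u ⊗ (a *: v + v') = a *: (u ⊗ v) + u ⊗ v'.
Proof. by have [_ h] := tens_is_bilinear U V; exact: (h u a v v'). Qed.

Lemma tens_linearl (v : V) : linear (fun u : U => u ⊗ v).
Proof. by move=> a u u'; apply: tensPl. Qed.

Lemma tens_linearr (u : U) : linear (fun v : V => u ⊗ v).
Proof. by move=> a v v'; apply: tensPr. Qed.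

Lemma tensor_linear_ext (f g : tensor U V -> W) : linear f -> linear g ->
  (forall u v, f (u ⊗ v) = g (u ⊗ v)) -> f =1 g.
Proof.
move=> hf hg h t; rewrite (tensor_sum_tens t) (linear_bigsum hf) (linear_bigsum hg).
by apply: eq_bigr.
Qed.

End TensorLift.

(** Valid for every function [f], as [tlift] is a finite sum over one fixed representative of the
    tensor. *)
Lemma tlift_comp (K : fieldType) (U V W W' : lmodType K) (L : W -> W')
    (f : U -> V -> W) t :
  linear L -> L (tlift f t) = tlift (fun x y => L (f x y)) t.
Proof. by move=> h; apply: linear_bigsum. Qed.

Lemma tlift_param (K : fieldType) (U V W W' : lmodType K) (f : W' -> U -> V -> W) t :
  (forall u v, linear (fun a => f a u v)) -> linear (fun a => tlift (f a) t).
Proof.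
move=> h k a a'; rewrite /tlift /bilinear_eval scaler_sumr -big_split /=.
by apply: eq_bigr => x _; apply: h.
Qed.

Section TensorAlgebra.
Variables (K : fieldType) (A : algType K).

Lemma tensor_mul_blinear_inner (t : tensor A A) :
  blinear (fun a b => tlift (fun c d => (a * c) ⊗ (b * d)) t : tensor A A).
Proof.
split=> [b|a]; apply: tlift_param => c d k x y.
- by rewrite mulrDl -scalerAl tensPl.
- by rewrite mulrDl -scalerAl tensPr.
Qed.

Lemma tensor_mul_blinear_tens (a b : A) :
  blinear (fun c d => (a * c) ⊗ (b * d) : tensor A A).
Proof.
split=> [d|c] k x y.
- by rewrite mulrDr -scalerAr tensPl.
- by rewrite mulrDr -scalerAr tensPr.
Qed.

Lemma tensor_mulE (a b c d : A) : tensor_mul (a ⊗ b) (c ⊗ d) = (a * c) ⊗ (b * d).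
Proof.
rewrite /tensor_mul tliftE; last exact: tensor_mul_blinear_inner.
by rewrite tliftE //; apply: tensor_mul_blinear_tens.
Qed.

Lemma tensor_mul_linearl (t : tensor A A) : linear (fun s => tensor_mul s t).
Proof. exact/tlift_linear/tensor_mul_blinear_inner. Qed.

Lemma tensor_mul_linearr (s : tensor A A) : linear (tensor_mul s).
Proof. by apply: tlift_param => a b; apply/tlift_linear/tensor_mul_blinear_tens. Qed.

Section Form.
Variables (form : A -> A -> K).
Hypothesis formB : blinear (form : A -> A -> K^o).

Lemma tensor_form_blinear_inner (t : tensor A A) :
  blinear (fun a b => tlift (fun c d => form a c * form b d : K^o) t).
Proof.
case: formB => hl _; split=> [b|a]; apply: tlift_param => c d k x y.
- by rewrite (hl c k x y) mulrDl scalerAl.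
- by rewrite (hl d k x y) mulrDr scalerAr.
Qed.

Lemma tensor_form_linearl (t : tensor A A) :
  linear ((fun s => tensor_form form s t) : tensor A A -> K^o).
Proof. exact/tlift_linear/tensor_form_blinear_inner. Qed.

Lemma tensor_form_tens (a b : A) (t : tensor A A) :
  tensor_form form (a ⊗ b) t = tlift (fun c d => form a c * form b d : K^o) t.
Proof. by rewrite /tensor_form tliftE //; apply: tensor_form_blinear_inner. Qed.

End Form.
End TensorAlgebra.

(** * Coordinates in free modules and in their tensor products *)

Section FreeModule.
Variables (K : fieldType) (M : choiceType).
Implicit Types (a : {malg K[M]}) (k : M).

Lemma malg_expand a : a = \sum_(k <- msupp a) a@_k *: << k >>.
Proof.
rewrite {1}(monalgE a); apply: eq_bigr => k _; apply/malgP => k'.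
by rewrite mcoeffZ !mcoeffU mulr_natr.
Qed.

Lemma mcoeff_linear k : linear ((fun a => a@_k) : {malg K[M]} -> K^o).
Proof. by move=> c x y; rewrite mcoeffD mcoeffZ. Qed.

Lemma malg_linear_ext (W : lmodType K) (f g : {malg K[M]} -> W) :
  linear f -> linear g -> (forall k, f << k >> = g << k >>) -> f =1 g.
Proof.
move=> hf hg h a; rewrite (malg_expand a) (linear_bigsum hf) (linear_bigsum hg).
by apply: eq_bigr => k _; rewrite (linear_scale hf) (linear_scale hg) h.
Qed.

Section LinExt.
Variables (W : lmodType K) (h : M -> W).

Definition lin_ext a : W := \sum_(k <- msupp a) a@_k *: h k.

(** Lets elements with different supports be summed over a common index set. *)
Lemma lin_ext_wide a (d : {fset M}) :
  (msupp a `<=` d)%fset -> lin_ext a = \sum_(k <- d) a@_k *: h k.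
Proof.
move=> le; rewrite [LHS](big_fset_incl _ le) => //= k _ /mcoeff_outdom ->.
by rewrite scale0r.
Qed.

Lemma lin_ext_linear : linear lin_ext.
Proof.
move=> c a b; pose d := (msupp a `|` msupp b)%fset.
rewrite !(@lin_ext_wide _ d) ?fsubsetUl ?fsubsetUr //.
  rewrite scaler_sumr -big_split /=; apply: eq_bigr => k _.
  by rewrite mcoeffD mcoeffZ scalerDl scalerA.
apply: fsubset_trans (msuppD_le _ _) _; apply: fsetSU; exact: msuppZ_le.
Qed.

Lemma lin_extE k : lin_ext << k >> = h k.
Proof. by rewrite /lin_ext msuppU oner_eq0 big_seq_fset1 mcoeffUU scale1r. Qed.

End LinExt.

(** Contraction of the left factor with the coordinate form of [k]. *)
Definition lcoef (V : lmodType K) k : tensor {malg K[M]} V -> V :=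
  tlift (fun (x : {malg K[M]}) v => x@_k *: v).

Lemma lcoef_blinear (V : lmodType K) k :
  blinear (fun (x : {malg K[M]}) (v : V) => x@_k *: v).
Proof.
split=> [v|x] c a b; first by rewrite mcoeffD mcoeffZ scalerDl scalerA.
by rewrite scalerDr !scalerA mulrC.
Qed.

Lemma lcoef_linear (V : lmodType K) k : linear (@lcoef V k).
Proof. exact/tlift_linear/lcoef_blinear. Qed.

Lemma lcoef_tens (V : lmodType K) k (x : {malg K[M]}) (v : V) : lcoef k (x ⊗ v) = x@_k *: v.
Proof. by rewrite /lcoef tliftE //; apply: lcoef_blinear. Qed.

(** Expanding the left factors shows that a tensor [w] is the finite sum of the
    [<< k >> ⊗ lcoef k w], so a tensor with zero contractions vanishes; this is applied to the
    difference. *)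
Lemma lcoef_ext (V : lmodType K) (s t : tensor {malg K[M]} V) :
  (forall k, lcoef k s = lcoef k t) -> s = t.
Proof.
have eq0 (w : tensor {malg K[M]} V) : (forall k, lcoef k w = 0) -> w = 0.
  move=> h; pose d : {fset M} := \big[fsetU/fset0]_(x <- repr w) msupp x.1.
  have le x : x \in repr w -> (msupp x.1 `<=` d)%fset.
    move=> xw; rewrite /d; elim: (repr w) xw => // y l IHl.
    rewrite inE big_cons => /predU1P[->|/IHl]; first exact: fsubsetUl.
    by move=> h'; apply: fsubset_trans h' (fsubsetUr _ _).
  transitivity (\sum_(k <- d) (<< k >> : {malg K[M]}) ⊗ lcoef k w); last first.
    by apply: big1 => k _; rewrite h (linear_zero (tens_linearr _)).
  rewrite {1}(tensor_sum_tens w).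
  under [RHS]eq_bigr => k _ do rewrite /lcoef /tlift /bilinear_eval
    (linear_bigsum (tens_linearr _)).
  rewrite exchange_big /=; apply: eq_big_seq => x xw.
  rewrite {1}(malg_expand x.1) -/(lin_ext (fun k => << k >>) x.1) (lin_ext_wide _ (le _ xw)).
  rewrite (linear_bigsum (tens_linearl _)); apply: eq_bigr => k _.
  by rewrite (linear_scale (tens_linearl _)) (linear_scale (tens_linearr _)).
move=> h; apply/eqP; rewrite -subr_eq0; apply/eqP/eq0 => k.
rewrite -scaleN1r addrC (@lcoef_linear V k (-1) t s).
by rewrite scaleN1r h addNr.
Qed.

End FreeModule.

(** * The Hopf algebra of a monoid with splittings *)

Section Combinations.
Variables (K : fieldType) (V : lmodType K).

(** Spans attach coefficients to vectors, not to indices, so terms with the same vector have to be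
    merged. *)
Lemma regroup_comb (I : eqType) (s : seq I) (F : I -> V) (c : I -> K) :
  \sum_(i <- s) c i *: F i =
  \sum_(v <- undup (map F s)) (\sum_(i <- s | F i == v) c i) *: v.
Proof.
under [RHS]eq_bigr => v _ do rewrite scaler_suml.
transitivity (\sum_(v <- undup (map F s)) \sum_(i <- s | F i == v) c i *: F i); last first.
  by apply: eq_bigr => v _; apply: eq_bigr => i /eqP ->.
rewrite (exchange_big_dep xpredT) //=; apply: eq_big_seq => i si.
rewrite -big_filter (eq_filter (a2 := pred1 (F i))) => [|v]; last by rewrite /= eq_sym.
by rewrite filter_pred1_uniq ?undup_uniq ?mem_undup ?map_f // big_seq1.
Qed.

Lemma lspan_comb (S : set V) (I : eqType) (s : seq I) (F : I -> V) (c : I -> K) :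
  (forall i, i \in s -> S (F i)) -> lspan S (\sum_(i <- s) c i *: F i).
Proof.
move=> h; exists (undup (map F s)), (fun v => \sum_(i <- s | F i == v) c i).
split; last exact: regroup_comb.
by move=> v; rewrite mem_undup => /mapP[i si ->]; apply: h.
Qed.

Lemma nonneg_rat_sum (S : set V) (I : eqType) (s : seq I) (F : I -> V) :
  (forall i, i \in s -> S (F i)) -> nonneg_rat_comb S (\sum_(i <- s) F i).
Proof.
move=> h; exists (undup (map F s)), (fun v => (count (fun i => F i == v) s)%:R).
split; first exact: undup_uniq.
- by move=> v; rewrite mem_undup => /mapP[i si ->]; apply: h.
- by move=> v; apply: Num.Theory.ler0n.
- under eq_bigr => i _ do rewrite -[F i]scale1r.
  rewrite (regroup_comb s F (fun=> 1)); apply: eq_bigr => v _.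
  by rewrite ratr_nat -sum1_count natr_sum.
Qed.

Lemma nonneg_rat_mem (S : set V) v : S v -> nonneg_rat_comb S v.
Proof.
by move=> Sv; have := @nonneg_rat_sum S _ [:: tt] (fun=> v) (fun _ _ => Sv); rewrite big_seq1.
Qed.

Lemma lspan0 (S : set V) : lspan S 0.
Proof. by exists [::], (fun=> 0); rewrite big_nil. Qed.

Lemma lspanD (S : set V) u v : lspan S u -> lspan S v -> lspan S (u + v).
Proof.
move=> [s [c [sS ->]]] [t [b [tS ->]]].
pose F (x : bool * V) := x.2; pose C (x : bool * V) := if x.1 then c x.2 else b x.2.
have -> : \sum_(x <- s) c x *: x + \sum_(x <- t) b x *: x =
    \sum_(x <- [seq (true, x) | x <- s] ++ [seq (false, x) | x <- t]) C x *: F x.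
  by rewrite big_cat !big_map.
apply: lspan_comb => x; rewrite mem_cat => /orP[] /mapP[y + ->]; [exact: sS|exact: tS].
Qed.

Lemma lspanZ (S : set V) a u : lspan S u -> lspan S (a *: u).
Proof.
move=> [s [c [sS ->]]]; rewrite scaler_sumr.
under eq_bigr => x _ do rewrite scalerA.
exact: lspan_comb.
Qed.

Lemma lspan_sum (S : set V) (I : eqType) (s : seq I) (F : I -> V) :
  (forall i, i \in s -> lspan S (F i)) -> lspan S (\sum_(i <- s) F i).
Proof.
elim: s => [|i s IHs] h; first by rewrite big_nil; apply: lspan0.
rewrite big_cons; apply: lspanD; first by apply: h; rewrite mem_head.
by apply: IHs => j js; apply: h; rewrite inE js orbT.
Qed.

Lemma lspan_mem (S : set V) v : S v -> lspan S v.
Proof.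
move=> Sv; exists [:: v], (fun=> 1); split; last by rewrite big_seq1 scale1r.
by move=> x; rewrite inE => /eqP ->.
Qed.

End Combinations.

(** * Coproduct, counit and antipode on a monoid algebra *)

Section MonoidHopf.
Variables (K : fieldType) (charK : [pchar K] =i pred0) (M : conomType).
Local Notation A := {malg K[M]}.
Local Notation AA := (tensor A A).
Local Notation "k · l" := (mmul k l) (at level 40, left associativity).
Local Notation e k := (<< k >> : A).

(** Diagrams under juxtaposition in abstract form: [aut] is the order of the automorphism group,
    [splits] has one pair per cut, and [conn] marks the connected elements. *)
Variables (aut : M -> nat) (splits : M -> seq (M * M)) (conn : M -> Prop).
Hypothesis aut_gt0 : forall k, (0 < aut k)%N.
Hypothesis aut1 : aut mone = 1%N.
Hypothesis count_splits : forall k l m,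
  (count_mem (k, l) (splits m) * (aut k * aut l) = (k · l == m) * aut (k · l))%N.
Hypothesis splitsM : forall m m', perm_eq (splits (m · m'))
  [seq (x.1 · y.1, x.2 · y.2) | x <- splits m, y <- splits m'].
Hypothesis conn_neq1 : forall k, conn k -> k <> mone.
Hypothesis conn_irr : forall k l, conn (k · l) -> k = mone \/ l = mone.
Hypothesis conn_ind : forall P : M -> Prop, P mone -> (forall k, conn k -> P k) ->
  (forall k l, P k -> P l -> P (k · l)) -> forall k, P k.

Lemma natr_eq0 (n : nat) : ((n%:R : K) == 0) = (n == 0%N).
Proof. by move/pcharf0P: charK => ->. Qed.

Lemma aut_neq0 k : (aut k)%:R != 0 :> K.
Proof. by rewrite natr_eq0 -lt0n. Qed.

Lemma malg_baseM k l : e k * e l = e (k · l).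
Proof. by rewrite malgM_def fgmulUU mulr1. Qed.

Lemma malg_base_inj : injective (fun k => e k).
Proof.
move=> k l /(congr1 (fun a => a@_l)); rewrite !mcoeffU eqxx.
by case: eqP => // _ /eqP; rewrite eq_sym oner_eq0.
Qed.

Definition tcoef (k l : M) (t : AA) : K := (lcoef k t)@_l.

Lemma tcoef_linear k l : linear (tcoef k l : AA -> K^o).
Proof. by move=> c x y; rewrite /tcoef lcoef_linear mcoeffD mcoeffZ. Qed.

Lemma tcoef_tens k l (a b : A) : tcoef k l (a ⊗ b) = a@_k * b@_l.
Proof. by rewrite /tcoef lcoef_tens mcoeffZ. Qed.

Lemma tcoef_ext (s t : AA) : (forall k l, tcoef k l s = tcoef k l t) -> s = t.
Proof. by move=> h; apply: lcoef_ext => k; apply/malgP => l; apply: h. Qed.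

Definition split_sum (s : seq (M * M)) : AA := \sum_(x <- s) e x.1 ⊗ e x.2.

Lemma tcoef_split_sum k l s : tcoef k l (split_sum s) = (count_mem (k, l) s)%:R.
Proof.
rewrite (linear_bigsum (tcoef_linear k l)) -sum1_count natr_sum [RHS]big_mkcond /=.
apply: eq_bigr => -[i j] _; rewrite tcoef_tens !mcoeffU -natrM mulnb -pair_eqE /= /pair_eq /=.
by case: ifP.
Qed.

Definition malg_Delta : A -> AA := lin_ext (fun m => split_sum (splits m)).

Lemma malg_Delta_linear : linear malg_Delta.
Proof. exact: lin_ext_linear. Qed.

Lemma malg_DeltaE m : malg_Delta (e m) = split_sum (splits m).
Proof. exact: lin_extE. Qed.

Lemma tcoef_Delta k l (a : A) :
  tcoef k l (malg_Delta a) * (aut k * aut l)%:R = (aut (k · l))%:R * a@_(k · l).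
Proof.
rewrite [RHS]mulrC.
have h : (fun a => tcoef k l (malg_Delta a) * (aut k * aut l)%:R : K^o) =1
    (fun a => a@_(k · l) * (aut (k · l))%:R).
  apply: malg_linear_ext => [c x y|c x y|m].
  - by rewrite malg_Delta_linear (tcoef_linear k l) mulrDl scalerAl.
  - by rewrite mcoeffD mcoeffZ mulrDl scalerAl.
  - by rewrite malg_DeltaE tcoef_split_sum mcoeffU -!natrM count_splits eq_sym.
exact: h a.
Qed.

(** As automorphism orders are positive, the counting formula determines the splittings up to order;
    this identifies them for the unit and for connected elements. *)
Lemma perm_splits m s :
  (forall k l, count_mem (k, l) s * (aut k * aut l) = (k · l == m) * aut (k · l))%N ->
  perm_eq (splits m) s.
Proof.
move=> h; apply/allP => -[k l] _ /=; apply/eqP/eqP.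
by rewrite -(@eqn_pmul2r (aut k * aut l)) ?muln_gt0 ?aut_gt0 // count_splits h.
Qed.

Lemma splits1 : perm_eq (splits mone) [:: (mone, mone)].
Proof.
apply: perm_splits => k l /=; rewrite addn0 -pair_eqE /= /pair_eq /=.
have -> : (k · l == mone) = (mone == k) && (mone == l).
  by rewrite ![mone == _]eq_sym; apply/unitmP/andP.
case: eqP => [<-|//]; case: eqP => [<-|//] /=.
by rewrite mul1m aut1.
Qed.

Lemma splits_conn c : conn c -> perm_eq (splits c) [:: (c, mone); (mone, c)].
Proof.
move=> hc; have c1 := conn_neq1 hc; apply: perm_splits => k l /=.
rewrite addn0 -!pair_eqE /= /pair_eq /=.
have [ec|nc] := eqVneq (k · l) c.
  have [k1|l1] : k = mone \/ l = mone by apply: conn_irr; rewrite ec.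
    have lc : l = c by rewrite -ec k1 mul1m.
    have n1 : (c == mone) = false by apply/eqP.
    by rewrite k1 lc aut1 n1 !eqxx /= add0n !mul1n mul1m.
  have kc : k = c by rewrite -ec l1 mulm1.
  have n1 : (mone == c) = false by apply/eqP => /esym.
  by rewrite l1 kc aut1 n1 !eqxx /= addn0 muln1 !mul1n mulm1.
have -> : (c == k) && (mone == l) = false.
  by apply/negP => /andP[/eqP ek /eqP el]; rewrite -ek -el mulm1 eqxx in nc.
suff -> : (mone == k) && (c == l) = false by [].
by apply/negP => /andP[/eqP ek /eqP el]; rewrite -ek -el mul1m eqxx in nc.
Qed.

Lemma malg_Delta1 : malg_Delta 1 = 1 ⊗ 1.
Proof. by rewrite malg_DeltaE /split_sum (perm_big _ splits1) big_seq1. Qed.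

Lemma malg_Delta_conn c : conn c -> malg_Delta (e c) = e c ⊗ 1 + 1 ⊗ e c.
Proof.
by move=> /splits_conn h; rewrite malg_DeltaE /split_sum (perm_big _ h) big_cons big_seq1.
Qed.

Lemma malg_bilinear_ext (W : lmodType K) (f g : A -> A -> W) : blinear f -> blinear g ->
  (forall k l, f (e k) (e l) = g (e k) (e l)) -> f =2 g.
Proof.
move=> [fl fr] [gl gr] h a b.
have ext k := malg_linear_ext (fr (e k)) (gr (e k)) (h k).
exact: (malg_linear_ext (fl b) (gl b) (fun k => ext k b)).
Qed.

Lemma malg_DeltaM a b : malg_Delta (a * b) = tensor_mul (malg_Delta a) (malg_Delta b).
Proof.
have D := malg_Delta_linear.
apply: (malg_bilinear_ext (f := fun a b => malg_Delta (a * b))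
  (g := fun a b => tensor_mul (malg_Delta a) (malg_Delta b))) => [||k l].
- split=> [y|x] c z t; first by rewrite mulrDl -scalerAl D.
  by rewrite mulrDr -scalerAr D.
- split=> [y|x] c z t; first by rewrite D tensor_mul_linearl.
  by rewrite D tensor_mul_linearr.
- rewrite malg_baseM !malg_DeltaE /split_sum (perm_big _ (splitsM k l)) big_allpairs_dep /=.
  rewrite (linear_bigsum (tensor_mul_linearl _)); apply: eq_bigr => x _.
  rewrite (linear_bigsum (tensor_mul_linearr _)); apply: eq_bigr => y _.
  by rewrite tensor_mulE !malg_baseM.
Qed.

(** Both maps are multiplicative and agree on connected elements, which generate the monoid. *)
Lemma Delta_unique (Delta : {linear A -> AA}) : is_algebra_map_to_tensor Delta ->
  (forall c, conn c -> Delta (e c) = e c ⊗ 1 + 1 ⊗ e c) -> Delta =1 malg_Delta.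
Proof.
move=> [D1 DM] Dc; apply: malg_linear_ext; [exact: linearP|exact: malg_Delta_linear|].
apply: conn_ind => [|c hc|k l hk hl].
- by rewrite [LHS]D1 [RHS]malg_Delta1.
- by rewrite Dc // malg_Delta_conn.
- by rewrite -malg_baseM DM malg_DeltaM hk hl.
Qed.

Lemma eps_unique (eps : {scalar A}) : is_algebra_map_to_field eps ->
  (forall c, conn c -> eps (e c) = 0) -> eps =1 (fun a => a@_mone).
Proof.
move=> [e1 eM] ec; apply: (malg_linear_ext (W := K^o)) => [||k].
- by move=> c x y; rewrite linearP.
- exact: mcoeff_linear.
have E : forall k, eps (e k) = (k == mone)%:R.
  apply: conn_ind => [|c hc|i j hi hj]; first by rewrite eqxx.
    by rewrite ec //; case: eqP => // /(conn_neq1 hc).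
  rewrite -malg_baseM eM hi hj -natrM mulnb.
  by congr (_%:R); congr nat_of_bool; apply/andP/unitmP.
by rewrite E mcoeffU.
Qed.

(** For powers of one connected diagram this is a binomial coefficient. *)
Definition weight k l : K := (aut (k · l))%:R / ((aut k)%:R * (aut l)%:R).

Lemma tcoef_malg_Delta k l a : tcoef k l (malg_Delta a) = a@_(k · l) * weight k l.
Proof.
have n0 : (aut k * aut l)%:R != 0 :> K by rewrite natrM mulf_neq0 ?aut_neq0.
apply: (mulIf n0); rewrite tcoef_Delta /weight -natrM mulrA mulfVK //.
exact: mulrC.
Qed.

Lemma weight1l l : weight mone l = 1.
Proof. by rewrite /weight mul1m aut1 mul1r divff ?aut_neq0. Qed.

Lemma weight1r l : weight l mone = 1.
Proof. by rewrite /weight mulm1 aut1 mulr1 divff ?aut_neq0. Qed.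

(** Both sides are the automorphism order of the triple product divided by the three separate
    orders. *)
Lemma weight_cocycle i j l :
  weight i j * weight (i · j) l = weight j l * weight i (j · l).
Proof.
rewrite /weight mulmA; field.
by rewrite !aut_neq0.
Qed.

Lemma tlift_coef i j (t : AA) :
  @tlift K A A K^o (fun x y => x@_i * y@_j) t = tcoef i j t.
Proof.
rewrite /tcoef /lcoef (tlift_comp _ _ (@mcoeff_linear K M j)).
by apply: eq_tlift => x y; rewrite mcoeffZ.
Qed.

Lemma tlift_mulr (U V : lmodType K) (f : U -> V -> K) (t : tensor U V) (c : K) :
  @tlift K U V K^o f t * c = @tlift K U V K^o (fun x y => f x y * c) t.
Proof. exact: mulr_suml. Qed.

Lemma tensor_assoc_blinear :
  blinear (fun (s : AA) (c : A) => tlift (fun a b => a ⊗ (b ⊗ c)) s : tensor A AA).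
Proof.
split=> [c|s]; last by apply: tlift_param => a b k x y; rewrite tensPr tensPr.
apply: tlift_linear; split=> [b|a] k x y; first exact: tensPl.
by rewrite tensPl tensPr.
Qed.

Lemma tcoef_tensor_assoc i j l (s : AA) (c : A) :
  tcoef j l (lcoef i (tensor_assoc (s ⊗ c))) = tcoef i j s * c@_l.
Proof.
rewrite /tensor_assoc (tliftE _ _ tensor_assoc_blinear).
rewrite (tlift_comp _ _ (@lcoef_linear _ _ _ i)) (tlift_comp _ _ (tcoef_linear j l)).
rewrite -tlift_coef tlift_mulr; apply: eq_bigr => x _.
by rewrite lcoef_tens (linear_scale (tcoef_linear j l)) tcoef_tens -mulrA.
Qed.

Lemma malg_Delta_coassoc a :
  tensor_assoc (tlift (fun x y => malg_Delta x ⊗ y) (malg_Delta a)) =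
  tlift (fun x y => x ⊗ malg_Delta y) (malg_Delta a).
Proof.
apply: lcoef_ext => i; apply: tcoef_ext => j l.
pose L (u : tensor AA A) : K^o := tcoef j l (lcoef i (tensor_assoc u)).
have Ll : linear L.
  move=> k x y; rewrite /L /tensor_assoc (tlift_linear tensor_assoc_blinear).
  by rewrite lcoef_linear tcoef_linear.
rewrite -[LHS]/(L _) (tlift_comp _ _ Ll).
rewrite (tlift_comp _ _ (@lcoef_linear _ _ _ i)) (tlift_comp _ _ (tcoef_linear j l)).
(* The coefficients at [e i ⊗ (e j ⊗ e l)] are compared. Each side is the coefficient of [a] at the
   triple product times two weights, and the cocycle identity equates these. *)
transitivity (tcoef (i · j) l (malg_Delta a) * weight i j : K).
  rewrite -tlift_coef tlift_mulr; apply: eq_bigr => x _.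
  by rewrite /L tcoef_tensor_assoc tcoef_malg_Delta mulrAC.
transitivity (tcoef i (j · l) (malg_Delta a) * weight j l : K); last first.
  rewrite -tlift_coef tlift_mulr; apply: eq_bigr => x _.
  by rewrite lcoef_tens (linear_scale (tcoef_linear j l)) tcoef_malg_Delta -mulrA.
have key (x b c b' c' : K) : b * c = b' * c' -> x * c * b = x * c' * b'.
  by rewrite -2!mulrA ![_ * b]mulrC ![_ * b']mulrC => ->.
by rewrite !tcoef_malg_Delta mulmA; apply/key/weight_cocycle.
Qed.

Lemma malg_Delta_counitl a : tlift (fun x y => x@_mone *: y) (malg_Delta a) = a.
Proof.
(* Applying the counit on the left is literally the contraction [lcoef mone]. *)
apply/malgP => l; rewrite -/(lcoef mone _) -/(tcoef _ _ _) tcoef_malg_Delta.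
by rewrite mul1m weight1l mulr1.
Qed.

Lemma malg_Delta_counitr a : tlift (fun x y => y@_mone *: x) (malg_Delta a) = a.
Proof.
apply/malgP => l; transitivity (tcoef l mone (malg_Delta a)).
  rewrite -tlift_coef (tlift_comp _ _ (@mcoeff_linear K M l)); apply: eq_bigr => x _.
  by rewrite mcoeffZ mulrC.
by rewrite tcoef_malg_Delta mulm1 weight1r mulr1.
Qed.

Lemma conv_blinear (f g : A -> A) : linear f -> linear g -> blinear (fun x y => f x * g y).
Proof.
move=> hf hg; split=> [y|x] k a b; first by rewrite hf mulrDl -scalerAl.
by rewrite hg mulrDr -scalerAr.
Qed.

(** Multiplying out [f ⊗ g] is multiplicative because [A] is commutative. *)
Lemma conv_tensor_mul (f g : A -> A) : linear f -> linear g ->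
  {morph f : a b / a * b} -> {morph g : a b / a * b} ->
  {morph tlift (fun x y => f x * g y) : s t / tensor_mul s t >-> s * t}.
Proof.
move=> hf hg fM gM s t; have B := conv_blinear hf hg.
pose L := tlift (fun x y => f x * g y); have hL : linear L := tlift_linear B.
have LE x y : L (x ⊗ y) = f x * g y by apply: tliftE.
apply: (tensor_linear_ext (f := fun s => L (tensor_mul s t)) (g := fun s => L s * L t)).
- by move=> k x y; rewrite tensor_mul_linearl hL.
- by move=> k x y; rewrite hL mulrDl -scalerAl.
move=> a b; apply: (tensor_linear_ext (f := fun t => L (tensor_mul (a ⊗ b) t))
  (g := fun t => L (a ⊗ b) * L t)) => [k x y|k x y|c d].
- by rewrite tensor_mul_linearr hL.
- by rewrite hL mulrDr -scalerAr.
- by rewrite tensor_mulE !LE fM gM mulrACA.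
Qed.

(* [size (splits k)] is [2 ^ c] for [c] the number of factors [conn] in [k]. *)
Definition antipode_sign k : K := (-1) ^+ logn 2 (size (splits k)).

Definition malg_antipode : A -> A := lin_ext (fun k => antipode_sign k *: e k).

Lemma malg_antipode_linear : linear malg_antipode.
Proof. exact: lin_ext_linear. Qed.

Lemma malg_antipodeE k : malg_antipode (e k) = antipode_sign k *: e k.
Proof. exact: lin_extE. Qed.

Lemma splits_gt0 k : (0 < size (splits k))%N.
Proof.
have := count_splits mone k k; rewrite mul1m eqxx aut1 !mul1n => h.
have : (0 < count_mem (mone, k) (splits k))%N.
  by rewrite lt0n; apply/eqP => h0; have := aut_gt0 k; rewrite -h h0.
by move=> h'; apply: leq_trans h' (count_size _ _).
Qed.

(** Splittings of a product are pairs of splittings, so their numbers multiply and the 2-adic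
    valuations add. *)
Lemma antipode_signM k l : antipode_sign (k · l) = antipode_sign k * antipode_sign l.
Proof.
rewrite /antipode_sign (perm_size (splitsM k l)) size_allpairs -exprD.
by rewrite lognM ?splits_gt0.
Qed.

Lemma malg_antipodeM : {morph malg_antipode : a b / a * b}.
Proof.
have S := malg_antipode_linear; move=> a b.
apply: (malg_bilinear_ext (f := fun a b => malg_antipode (a * b))
  (g := fun a b => malg_antipode a * malg_antipode b)) => [||k l].
- by split=> [y|x] c z t; [rewrite mulrDl -scalerAl S|rewrite mulrDr -scalerAr S].
- exact: conv_blinear.
- by rewrite malg_baseM !malg_antipodeE antipode_signM -scalerAl -scalerAr scalerA malg_baseM.
Qed.

Lemma malg_antipode1 : malg_antipode 1 = 1.
Proof.
rewrite [LHS]malg_antipodeE /antipode_sign (perm_size splits1) /= logn1 expr0.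
exact: scale1r.
Qed.

Lemma malg_antipode_conn c : conn c -> malg_antipode (e c) = - e c.
Proof.
move=> hc; rewrite malg_antipodeE /antipode_sign (perm_size (splits_conn hc)) /=.
by rewrite expr1 scaleN1r.
Qed.

(** The convolution of two algebra maps is again multiplicative, so it is compared with the counit
    on connected elements only. Taking the antipode as [f] or as [g], with the identity as the other
    map, gives the two antipode axioms. *)
Lemma conv_counit (f g : A -> A) : linear f -> linear g ->
  {morph f : a b / a * b} -> {morph g : a b / a * b} -> f 1 = 1 -> g 1 = 1 ->
  (forall c, conn c -> f (e c) + g (e c) = 0) ->
  forall a, tlift (fun x y => f x * g y) (malg_Delta a) = (a@_mone)%:A.
Proof.
move=> hf hg fM gM f1 g1 fg; have B := conv_blinear hf hg.
pose L := tlift (fun x y => f x * g y); have hL : linear L := tlift_linear B.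
have LE x y : L (x ⊗ y) = f x * g y by apply: tliftE.
apply: (malg_linear_ext (f := fun a => L (malg_Delta a)) (g := fun a => (a@_mone)%:A)).
- by move=> k x y; rewrite malg_Delta_linear hL.
- by move=> k x y; rewrite mcoeffD mcoeffZ scalerDl scalerA.
apply: conn_ind => [|c hc|k l hk hl].
- by rewrite [X in L X]malg_Delta1 LE f1 g1 mulr1 mcoeffU eqxx scale1r.
- rewrite malg_Delta_conn // (linear_add hL) !LE f1 g1 mulr1 mul1r fg // mcoeffU.
  by case: eqP => [/(conn_neq1 hc)//|_]; rewrite scale0r.
- have LM : {morph L : s t / tensor_mul s t >-> s * t} := conv_tensor_mul hf hg fM gM.
  rewrite -malg_baseM malg_DeltaM LM hk hl malg_baseM.
  rewrite -scalerAl mul1r scalerA !mcoeffU -natrM mulnb; congr (_%:R *: _).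
  by congr nat_of_bool; apply/andP/unitmP.
Qed.

(** The antipode is diagonal in the basis, hence respects the grading. *)
Lemma mcoeff_antipode a k : (malg_antipode a)@_k = antipode_sign k * a@_k.
Proof.
apply: (malg_linear_ext (W := K^o) (f := fun a => (malg_antipode a)@_k)
  (g := fun a => antipode_sign k * a@_k)) => [c x y|c x y|l].
- by rewrite malg_antipode_linear mcoeffD mcoeffZ.
- by rewrite mcoeffD mcoeffZ mulrDr mulrCA.
- by rewrite malg_antipodeE mcoeffZ !mcoeffU; case: eqP => [->|_] //; rewrite !mulr0.
Qed.

(** * The grading and its basis *)

Section Graded.
Variables (r : nat) (deg : M -> {ffun 'I_r -> nat}).
Hypothesis degM : forall k l, deg (k · l) = deg k + deg l.
Hypothesis deg1 : deg mone = 0.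
Hypothesis deg_eq0 : forall k, deg k = 0 -> k = mone.

Definition mbase : set A := fun x => exists k, x = e k.
Definition mbase_deg d : set A := fun x => exists k, deg k = d /\ x = e k.
Definition mcomp d : set A := lspan (mbase_deg d).

(** Turns membership in a span into a condition on the support, which is easier to use in the
    grading axioms. *)
Lemma mcompP d a : mcomp d a <-> forall k, a@_k != 0 -> deg k = d.
Proof.
split=> [[s [c [sS ->]]] k|h].
  rewrite (linear_bigsum (@mcoeff_linear K M k)) => /eqP nz.
  apply: contrapT => dk; apply: nz; rewrite big_seq big1 // => x /sS[j [dj ->]].
  rewrite mcoeffZ mcoeffU; case: eqP => [ej|_]; last by rewrite mulr0.
  by case: dk; rewrite -ej.
rewrite (malg_expand a); apply: lspan_comb => k ks; exists k; split=> //.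
by apply: h; rewrite mcoeff_neq0.
Qed.

Lemma mcomp_base k : mcomp (deg k) (e k).
Proof. by apply: lspan_mem; exists k. Qed.

Lemma mcomp0 d : mcomp d 0.
Proof. exact: lspan0. Qed.

Lemma malg_graded : is_graded_algebra mcomp.
Proof.
split.
- move=> d; split=> [|k a b ha hb]; first exact: mcomp0.
  by apply: lspanD hb; apply: lspanZ.
- move=> a; exists (undup (map deg (msupp a))),
    (fun d => \sum_(k <- msupp a | deg k == d) a@_k *: e k).
  split=> [d|].
    rewrite -big_filter; apply: lspan_comb => k; rewrite mem_filter => /andP[/eqP dk _].
    by exists k.
  rewrite (exchange_big_dep xpredT) //= [LHS]malg_expand; apply: eq_big_seq => k ks.
  rewrite -big_filter (eq_filter (a2 := pred1 (deg k))) => [|v]; last by rewrite /= eq_sym.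
  by rewrite filter_pred1_uniq ?undup_uniq ?mem_undup ?map_f // big_seq1.
- move=> s a_ us ha e0 d ds; apply/malgP => k; rewrite mcoeff0.
  apply/eqP/negPn/negP => nz; have dk := (mcompP d (a_ d)).1 (ha d) k nz.
  have := congr1 (mcoeff k) e0; rewrite (linear_bigsum (@mcoeff_linear K M k)) mcoeff0.
  rewrite (bigD1_seq d) //= big1 ?addr0 => [h|d' nd]; first by rewrite h eqxx in nz.
  apply/eqP/negPn/negP => nz'; have := (mcompP d' (a_ d')).1 (ha d') k nz'.
  by rewrite dk => dd; rewrite dd eqxx in nd.
- by rewrite -deg1; apply: mcomp_base.
- move=> d d' a b /mcompP ha /mcompP hb; rewrite malgME.
  apply: lspan_sum => k ks; apply: lspan_sum => l ls.
  have -> : << a@_k * b@_l *g k · l >> = (a@_k * b@_l) *: e (k · l).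
    by apply/malgP => j; rewrite mcoeffZ !mcoeffU mulr_natr.
  apply: lspanZ; rewrite -(ha k) ?mcoeff_neq0 // -(hb l) ?mcoeff_neq0 // -degM.
  exact: mcomp_base.
Qed.

(** Otherwise the counting formula has right-hand side 0, while all factors on the left are
    positive. *)
Lemma splits_mul m k l : (k, l) \in splits m -> k · l = m.
Proof.
rewrite -has_pred1 has_count => h; have := count_splits k l m.
case: eqP => // _ /eqP; rewrite mul0n !muln_eq0 => /orP[/eqP h0|/orP[] /eqP h0].
- by rewrite h0 in h.
- by have := aut_gt0 k; rewrite h0.
- by have := aut_gt0 l; rewrite h0.
Qed.

Lemma malg_Delta_graded d a : mcomp d a -> tensor_comp mcomp d (malg_Delta a).
Proof.
move=> /mcompP ha; rewrite /malg_Delta /lin_ext; apply: lspan_sum => k ks; apply: lspanZ.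
apply: lspan_sum => -[i j] /splits_mul ij; apply: lspan_mem.
exists (deg i), (deg j), (e i), (e j); split=> //; try exact: mcomp_base.
by rewrite -degM ij ha // mcoeff_neq0.
Qed.

Lemma lin_indep_mbase (S : set A) : (forall x, S x -> mbase x) -> lin_indep S.
Proof.
move=> h s us sS c e0 x xs; have [k xk] := h _ (sS _ xs).
have := congr1 (mcoeff k) e0; rewrite (linear_bigsum (@mcoeff_linear K M k)) mcoeff0.
rewrite (bigD1_seq x) //= big_seq_cond big1 => [|y /andP[ys yx]].
  by rewrite addr0 mcoeffZ xk mcoeffU eqxx mulr1.
have [l yl] := h _ (sS _ ys); rewrite mcoeffZ yl mcoeffU.
by case: eqP => [lk|_]; [rewrite yl lk -xk eqxx in yx|rewrite mulr0].
Qed.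

Lemma malg_graded_basis : is_graded_basis mcomp mbase.
Proof.
split=> [_ [k ->]|d]; first by exists (deg k); apply: mcomp_base.
have -> : (fun b => mbase b /\ mcomp d b) = mbase_deg d.
  apply/funext => x; apply/propext; split=> [[[k ->] /mcompP h]|[k [<- ->]]].
    by exists k; split=> //; apply: h; rewrite mcoeffU eqxx oner_neq0.
  by split; [exists k|apply: mcomp_base].
split=> //; apply: lin_indep_mbase => x [k [_ ->]]; by exists k.
Qed.

(** * The PSH axioms *)

Section PSH.
Variables (Delta : {linear A -> AA}) (eps : {scalar A}) (form : {biscalar A}).
Hypothesis Delta_alg : is_algebra_map_to_tensor Delta.
Hypothesis Delta_conn : forall c, conn c -> Delta (e c) = e c ⊗ 1 + 1 ⊗ e c.
Hypothesis eps_alg : is_algebra_map_to_field eps.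
Hypothesis eps_conn : forall c, conn c -> eps (e c) = 0.
Hypothesis formE : forall k l, form (e k) (e l) = ((k == l) * aut k)%:R.

Lemma form_base k a : form (e k) a = (aut k)%:R * a@_k.
Proof.
apply: (malg_linear_ext (W := K^o) (f := form (e k)) (g := fun a => (aut k)%:R * a@_k)).
- by move=> c x y; rewrite linearPr.
- by move=> c x y; rewrite mcoeffD mcoeffZ mulrDr mulrCA.
- by move=> l; rewrite formE mcoeffU natrM mulrC eq_sym.
Qed.

Lemma form_blinear : blinear (form : A -> A -> K^o).
Proof. by split=> [y|x] c a b; [rewrite linearPl|rewrite linearPr]. Qed.

Lemma Delta_eq : (Delta : A -> AA) = malg_Delta.
Proof. exact/funext/Delta_unique. Qed.

Lemma eps_eq : (eps : A -> K) = (fun a => a@_mone).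
Proof. exact/funext/eps_unique. Qed.

(** On basis elements [a] and [b] this is [tcoef_Delta], as the form is diagonal with entries
    [aut]. *)
Lemma malg_mul_adjoint a b c : tensor_form form (a ⊗ b) (malg_Delta c) = form (a * b) c.
Proof.
have fB := form_blinear.
apply: (malg_bilinear_ext (W := K^o)
  (f := fun a b => tensor_form form (a ⊗ b) (malg_Delta c))
  (g := fun a b => form (a * b) c)) => [||k l].
- split=> [y|x] z s t; first by rewrite tensPl (tensor_form_linearl fB).
  by rewrite tensPr (tensor_form_linearl fB).
- split=> [y|x] z s t; first by rewrite mulrDl -scalerAl linearPl.
  by rewrite mulrDr -scalerAr linearPl.
- rewrite malg_baseM form_base (tensor_form_tens fB) -tcoef_Delta -tlift_coef tlift_mulr.
  by apply: eq_bigr => x _; rewrite !form_base natrM mulrACA [RHS]mulrC.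
Qed.

Lemma monoid_Hopf : is_graded_Hopf_algebra mcomp Delta eps.
Proof.
have S := malg_antipode_linear.
split; rewrite ?Delta_eq ?eps_eq.
- exact: malg_graded.
- exact: malg_Delta_graded.
- move=> d a d0 /mcompP ha; apply/eqP/negPn/negP => /ha; rewrite deg1 => d1.
  by rewrite -d1 eqxx in d0.
- exact: Delta_alg.
- exact: eps_alg.
- exact: malg_Delta_coassoc.
- exact: malg_Delta_counitl.
- exact: malg_Delta_counitr.
- pose g := GRing.isLinear.Build K A A *:%R malg_antipode S.
  pose F : {linear A -> A} := HB.pack malg_antipode g.
  exists F; split=> [a|d a /mcompP ha]; last first.
    apply/mcompP => k nz; apply: ha; apply: contra_neq nz => h.
    by rewrite [LHS]mcoeff_antipode h mulr0.
  split; rewrite ?Delta_eq ?eps_eq.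
    apply: (conv_counit S (g := id)) => //;
      last by move=> c hc; rewrite malg_antipode_conn // addNr.
    + exact: malg_antipodeM.
    + exact: malg_antipode1.
  apply: (conv_counit (f := id) _ S) => //;
    last by move=> c hc; rewrite malg_antipode_conn // addrN.
  + exact: malg_antipodeM.
  + exact: malg_antipode1.
Qed.

Theorem monoid_PSH : is_rational_PSH_algebra mcomp Delta eps mbase form.
Proof.
split; rewrite ?Delta_eq ?eps_eq.
- exact: monoid_Hopf.
- exact: malg_graded_basis.
(* The norm must be a function on all of [A]; summing over the support yields [aut k] at [e k]. *)
- exists (fun x => \sum_(k <- msupp x) (aut k)%:R) => _ _ [k ->] [l ->].
  rewrite msuppU oner_eq0 big_seq_fset1 Num.Theory.ltr0n aut_gt0 formE; split=> //.
  rewrite (inj_eq malg_base_inj) ratr_nat.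
  by case: (k == l); rewrite ?mul1n ?mul0n.
- exact: malg_mul_adjoint.
- by move=> k a; rewrite linearZl_LR /= form_base aut1 mul1r.
- move=> a; split=> [/mcompP h|[k ->]]; last first.
    by rewrite -deg1; apply: lspanZ; apply: mcomp_base.
  exists a@_mone; apply/malgP => k; rewrite mcoeffZ mcoeffU.
  have [->|nk] := eqVneq mone k; first by rewrite mulr1.
  rewrite mulr0; apply/eqP/negPn/negP => /h /deg_eq0 k1.
  by rewrite k1 eqxx in nk.
- move=> _ _ [k ->] [l ->]; rewrite malg_baseM; apply: nonneg_rat_mem.
  by exists (k · l).
- move=> _ [k ->]; rewrite malg_DeltaE; apply: nonneg_rat_sum => x _.
  by exists (e x.1), (e x.2); split; [exists x.1|exists x.2|].
- by apply: nonneg_rat_mem; exists mone.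
- move=> _ [k ->]; exists ((k == mone)%:R); first exact: Num.Theory.ler0n.
  by rewrite mcoeffU ratr_nat.
Qed.

End PSH.

End Graded.

(** The explicit models, bundled: they show that maps with the prescribed properties exist. *)
Lemma exists_structures :
  exists (Delta : {linear A -> AA}) (eps : {scalar A}) (form : {biscalar A}),
  [/\ is_algebra_map_to_tensor Delta /\
        (forall c, conn c -> Delta (e c) = e c ⊗ 1 + 1 ⊗ e c),
      is_algebra_map_to_field eps /\ (forall c, conn c -> eps (e c) = 0)
    & forall k l, form (e k) (e l) = ((k == l) * aut k)%:R].
Proof.
pose gD := GRing.isLinear.Build K A AA *:%R malg_Delta malg_Delta_linear.
pose Delta : {linear A -> AA} := HB.pack malg_Delta gD.
have eps_linear : linear_for *%R ((fun a => a@_mone) : A -> K).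
  by move=> k x y; rewrite mcoeffD mcoeffZ.
pose ge := GRing.isLinear.Build K A K *%R ((fun a => a@_mone) : A -> K) eps_linear.
pose eps : {scalar A} := HB.pack ((fun a => a@_mone) : A -> K) ge.
(* The diagonal form, the sum over [k] of [aut k] times the two coefficients at [k]. *)
pose f (a b : A) : K := lin_ext (W := K^o) (fun k => (aut k)%:R * b@_k) a.
have fB : bilinear_for *%R *%R f.
  split=> [b|a] c x y.
    exact: (@lin_ext_linear K M K^o (fun k => (aut k)%:R * b@_k) c x y).
  rewrite -[RHS]/(c *: (f a x : K^o) + f a y) /f /lin_ext scaler_sumr -big_split /=.
  by apply: eq_bigr => k _; rewrite mcoeffD mcoeffZ /GRing.scale /=; ring.
pose gf := bilinear_isBilinear.Build K A A K *%R *%R f fB.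
pose form : {biscalar A} := HB.pack f gf.
exists Delta, eps, form; split; first split.
- by split; [exact: malg_Delta1|exact: malg_DeltaM].
- exact: malg_Delta_conn.
- split=> [|c hc]; last by rewrite /= mcoeffU; case: eqP => // /(conn_neq1 hc).
  split=> [|a b /=]; first by rewrite /= mcoeffU eqxx.
  exact: (rmorphM (@mcoeff M K mone)).
- move=> k l; rewrite /= /f lin_extE mcoeffU -natrM eq_sym mulnC.
  by [].
Qed.

End MonoidHopf.

(** * The algebra of closed diagrams *)

Section Instance.
Variables (K : fieldType) (r : nat) (p q : 'I_r -> nat).
Local Notation diag := (diagram p q).
Local Notation deg := (@diagram_degree r p q).

(** Connectedness is given for prediagrams; a class counts as connected when some representative
    is. *)
Definition connected_class (D : diag) : Prop :=
  exists2 d : prediagram p q, connected_diagram d & D = \pi_diag d.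

Lemma connected_class_neq1 D : connected_class D -> D <> mone.
Proof. by move=> [d cd ->]; apply: connected_neq1. Qed.

Lemma connected_class_irr D D' : connected_class (mmul D D') -> D = mone \/ D' = mone.
Proof. by move=> [d cd e]; apply: (connected_dmul cd); rewrite -e. Qed.

Lemma connected_class_ind (P : diag -> Prop) : P mone ->
  (forall D, connected_class D -> P D) ->
  (forall D D', P D -> P D' -> P (mmul D D')) -> forall D, P D.
Proof. by move=> P1 Pc; apply: diagram_ind => // d cd; apply: Pc; exists d. Qed.

Lemma niso_net_of (d d' : prediagram p q) :
  niso (net_of d) (net_of d') = ((\pi_diag d == \pi_diag d') * aut (\pi_diag d))%N.
Proof.
rewrite -niso_dnet; apply: niso_isom; apply: isom_sym; exact: isom_repr_pi.
Qed.

Lemma basic_invariants_of_degreeE (n_ : {ffun 'I_r -> nat}) :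
  @basic_invariants_of_degree K r p q n_ = @mbase_deg K diag r deg n_.
Proof.
apply/funext => x; apply/propext; split=> [[n [hp [hq [sigma ->]]]]|[D [dD ->]]].
  exists (\pi_diag (basic_prediagram hp hq sigma)); split=> //.
  by rewrite diagram_degree_pi net_degree_basic.
have [n [hp [hq [sigma iso]]]] := exists_basic (d := repr D) dD.
exists n, hp, hq, sigma; rewrite /basic_invariant /KX_diagram.
by congr << _ >>; rewrite -[LHS]reprK; apply/pi_eqE.
Qed.

Lemma basic_invariantsE : @basic_invariants K r p q = @mbase K diag.
Proof.
apply/funext => x; apply/propext; split=> [[n_]|[D ->]].
  by rewrite basic_invariants_of_degreeE => -[D [_ ->]]; exists D.
by exists (deg D); rewrite basic_invariants_of_degreeE; exists D.
Qed.

Lemma KX_compE : @KX_comp K r p q = @mcomp K diag r deg.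
Proof. by apply/funext => n_; rewrite /KX_comp basic_invariants_of_degreeE. Qed.

(** Every closed diagram is a basic invariant and transporters count isomorphisms, so the form of
    the theorem is diagonal with entries [aut]. *)
Lemma KX_formE (form : {biscalar KX K p q}) :
  is_KX_form form <->
  forall D D' : diag, form << D >> << D' >> = ((D == D') * aut D)%:R.
Proof.
split=> [[form_deg form_basic] D D'|formE].
- have [dD|dD] := eqVneq (deg D) (deg D'); last first.
    rewrite (form_deg (deg D) (deg D')) //;
      try by rewrite basic_invariants_of_degreeE; eexists.
    by case: eqP => // e; rewrite e eqxx in dD.
  have [n [hp [hq [sigma iso]]]] := exists_basic (d := repr D) (erefl (deg D)).
  have [n' [hp' [hq' [tau iso']]]] := exists_basic (d := repr D') (esym dD).
  (* The common degree fixes the number of strings; once the two numbers are identified, both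
     permutations live in the same symmetric group. *)
  have en : n = n' by rewrite -hp -hp'.
  case: n' / en hp' hq' tau iso' => hp' hq' tau iso'.
  rewrite (eq_irrelevance hp' hp) (eq_irrelevance hq' hq) in iso'.
  have eD : D = \pi_diag (basic_prediagram hp hq sigma).
    by rewrite -[LHS]reprK; apply/pi_eqE.
  have eD' : D' = \pi_diag (basic_prediagram hp hq tau).
    by rewrite -[LHS]reprK; apply/pi_eqE.
  have := form_basic _ _ hp hq sigma tau.
  by rewrite /basic_invariant /KX_diagram card_transporter niso_net_of -eD -eD'.
- split=> [m_ n_ x y mn|n_ n hp hq sigma tau].
    rewrite !basic_invariants_of_degreeE => -[D [dD ->]] [D' [dD' ->]].
    rewrite formE; case: eqP => // e; move: mn.
    by rewrite -dD -dD' e eqxx.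
  by rewrite [LHS]formE card_transporter niso_net_of.
Qed.

End Instance.

Theorem theorem1p6 (K : closedFieldType) (charK : [pchar K] =i pred0)
    (r : nat) (r_gt0 : (0 < r)%N) (p q : 'I_r -> nat) :
  (exists (Delta : {linear KX K p q -> tensor (KX K p q) (KX K p q)})
          (eps : {scalar KX K p q}) (form : {biscalar KX K p q}),
     [/\ is_KX_Delta Delta, is_KX_eps eps & is_KX_form form]) /\
  (forall (Delta : {linear KX K p q -> tensor (KX K p q) (KX K p q)})
          (eps : {scalar KX K p q}) (form : {biscalar KX K p q}),
     is_KX_Delta Delta -> is_KX_eps eps -> is_KX_form form ->
     is_rational_PSH_algebra (@KX_comp K r p q) Delta eps
       (@basic_invariants K r p q) form).
Proof.
have aut_gt0 := @aut_gt0 r p q; have aut1 := @aut_dunit r p q.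
have cs := @count_splits r p q; have sM := @splitsM r p q.
have c1 := @connected_class_neq1 r p q; have ci := @connected_class_irr r p q.
have cI := @connected_class_ind r p q.
split.
  have [Delta [eps [form [[DA Dc] [eA ec] fE]]]] :=
    exists_structures K aut_gt0 aut1 cs sM c1 ci.
  exists Delta, eps, form; split.
  - by split=> // d cd; apply: Dc; exists d.
  - by split=> // d cd; apply: ec; exists d.
  - exact/KX_formE.
move=> Delta eps form [DA Dc] [eA ec] /KX_formE fE.
rewrite KX_compE basic_invariantsE.
apply: (@monoid_PSH K charK (diagram p q) _ _ _ aut_gt0 aut1 cs sM c1 ci cI) => //.
- exact: diagram_degreeM.
- exact: diagram_degree1.
- exact: diagram_degree0.
- by move=> _ [d cd ->]; apply: Dc.
- by move=> _ [d cd ->]; apply: ec.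
Qed.
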